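(* Let $d\ge2$, $\beta\in[0,1]$, $\kappa>0$, and let $d_1$ be a pseudo-metric on $\mathbb{R}$. Then $\mathrm{PSSFG}(\cdot,\cdot;\beta,\kappa)$ is a pseudo-metric on $\mathcal{P}(\mathbb{R}^d)$: it is non-negative, symmetric, and there is a constant $C'>0$ with $\mathrm{PSSFG}(\mu,\xi;\beta,\kappa)\le C'[\mathrm{PSSFG}(\mu,\nu;\beta,\kappa)+\mathrm{PSSFG}(\nu,\xi;\beta,\kappa)]$ for all $\mu,\nu,\xi\in\mathcal{P}(\mathbb{R}^d)$.
   Context: $\mathcal{P}(\mathbb{R}^d)$: probability measures on $\mathbb{R}^d$ with finite moments. A pseudo-metric $d_1$ on $\mathbb{R}$ is non-negative, symmetric, with $d_1(x,z)\le C[d_1(x,y)+d_1(y,z)]$ for a universal $C>0$. $\mathbb{S}^{d-1}$ is the unit sphere; $\theta\sharp\mu$ is the pushforward under $x\mapsto\theta^\top x$. For probability measures $\rho,\eta$ on $\mathbb{R}$, $D_{fgw}(\rho,\eta;\beta,d_1)=\min_{\pi\in\Pi(\rho,\eta)}\Big\{(1-\beta)\int d_1(s,t)d\pi+\beta\iint[d_1(s,s')-d_1(t,t')]^2d\pi(s,t)d\pi(s',t')\Big\}$. The power spherical distribution $\mathrm{PS}(\cdot\mid\epsilon,\kappa)$ ($\epsilon\in\mathbb{S}^{d-1}$, $\kappa\ge0$) has density $C(\kappa,d)(1+\epsilon^\top x)^\kappa$ w.r.t. surface measure on $\mathbb{S}^{d-1}$, with $C(\kappa,d)=\big\{2^{d-1+\kappa}\pi^{(d-1)/2}\Gamma(\tfrac{d-1}{2}+\kappa)/\Gamma(d-1+\kappa)\big\}^{-1}$.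 $\mathrm{PSSFG}(\mu,\nu;\beta,\kappa)=\max_{\epsilon\in\mathbb{S}^{d-1}}\mathbb{E}_{\theta\sim\mathrm{PS}(\cdot\mid\epsilon,\kappa)}[D_{fgw}(\theta\sharp\mu,\theta\sharp\nu;\beta,d_1)]$. *)

(* Defs.v *)
From HB Require Import structures.
From mathcomp Require Import all_boot all_order all_algebra.
From mathcomp Require Import all_classical all_reals all_analysis.
Set Implicit Arguments. Unset Strict Implicit. Unset Printing Implicit Defensive.
Import Order.TTheory GRing.Theory Num.Theory.
Import numFieldNormedType.Exports.
Local Open Scope classical_set_scope.
Local Open Scope ring_scope.

Section PSSFG.
Variable R : realType.

(** Points of R^d are d-tuples, with the product (= Borel) sigma-algebra. *)
Definition dotp (d : nat) (a b : d.-tuple R) : R :=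
  \sum_(i < d) tnth a i * tnth b i.

Definition tnorm (d : nat) (x : d.-tuple R) : R := Num.sqrt (dotp x x).

Definition sphere (d : nat) : set (d.-tuple R) := [set e | tnorm e = 1].

(** Iterated Lebesgue integral over R^d (equals the d-dimensional Lebesgue
    integral for measurable non-negative integrands, by Tonelli). *)
Fixpoint iint (n : nat) : (n.-tuple R -> \bar R) -> \bar R :=
  match n return (n.-tuple R -> \bar R) -> \bar R with
  | 0 => fun f => f [tuple]
  | n'.+1 => fun f =>
      (\int[@lebesgue_measure R]_(x in setT)
          iint (fun t : n'.-tuple R => f (cons_tuple x t)))%E
  end.

(** Integral w.r.t. the surface measure of S^{d-1}, via the cone identity
    int_{S^{d-1}} g dsigma = d * int_{0<|x|<=1} g(x/|x|) dx. *)
Definition sphere_integral (d : nat) (g : d.-tuple R -> \bar R) : \bar R :=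
  (d%:R%:E * iint (fun x : d.-tuple R =>
      if ((0 < tnorm x) && (tnorm x <= 1))%R
      then g (map_tuple (fun a : R => (a / tnorm x)%R) x) else 0%E))%E.

Definition Gamma (s : R) : R :=
  fine (\int[@lebesgue_measure R]_(t in `]0%R, +oo[%classic : set R)
          ((t `^ (s - 1)) * expR (- t))%:E)%E.

(** normalising constant C(kappa, d) of the power spherical distribution *)
Definition PS_const (kappa : R) (d : nat) : R :=
  (2 `^ (d%:R - 1 + kappa) * pi `^ ((d%:R - 1) / 2)
    * Gamma ((d%:R - 1) / 2 + kappa) / Gamma (d%:R - 1 + kappa))^-1.

Definition PS_expect (d : nat) (eps : d.-tuple R) (kappa : R)
    (f : d.-tuple R -> \bar R) : \bar R :=
  ((PS_const kappa d)%:E *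
   sphere_integral (fun th => ((1 + dotp eps th) `^ kappa)%:E * f th))%E.

Definition coupling (rho eta : set R -> \bar R) (p : probability (R * R)%type R)
  : Prop :=
  forall A : set R, measurable A ->
    p (A `*` setT) = rho A /\ p (setT `*` A) = eta A.

Definition fgw_cost (beta : R) (d1 : R -> R -> R)
    (p : probability (R * R)%type R) : \bar R :=
  (((1 - beta)%:E * \int[p]_(st in setT) (d1 st.1 st.2)%:E)
   + beta%:E * \int[p]_(st in setT) \int[p]_(st' in setT)
        ((d1 st.1 st'.1 - d1 st.2 st'.2) ^+ 2)%:E)%E.

(** D_fgw(rho, eta; beta, d1) = min over couplings (taken as an infimum) *)
Definition D_fgw (rho eta : set R -> \bar R) (beta : R) (d1 : R -> R -> R)
  : \bar R :=
  ereal_inf [set fgw_cost beta d1 p | p in coupling rho eta].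

(** PSSFG(mu, nu; beta, kappa) = max over eps in the sphere (taken as a supremum) *)
Definition PSSFG (d : nat) (mu nu : set (d.-tuple R) -> \bar R)
    (beta kappa : R) (d1 : R -> R -> R) : \bar R :=
  ereal_sup [set PS_expect eps kappa
                 (fun th => D_fgw (pushforward mu (dotp th))
                                  (pushforward nu (dotp th)) beta d1)
            | eps in @sphere d].

(** P(R^d): probability measures with finite moments of every order *)
Definition finite_moments (d : nat) (mu : probability (d.-tuple R) R) : Prop :=
  forall k : nat, mu.-integrable setT (fun x => ((tnorm x) ^+ k)%:E).

Definition pseudo_metric (d1 : R -> R -> R) : Prop :=
  [/\ forall x y, 0 <= d1 x y,
      forall x y, d1 x y = d1 y x &
      exists C : R, 0 < C /\ forall x y z, d1 x z <= C * (d1 x y + d1 y z)].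

End PSSFG.

(* Main.v *)
Require Import Defs.
From HB Require Import structures.
From mathcomp Require Import all_boot all_order all_algebra.
From mathcomp Require Import all_classical all_reals all_analysis.
From mathcomp Require Import unstable measurable_realfun ring lra.
Set Implicit Arguments. Unset Strict Implicit. Unset Printing Implicit Defensive.
Import Order.TTheory GRing.Theory Num.Theory.
Local Open Scope classical_set_scope.
Local Open Scope ring_scope.

(** D_fgw(theta#mu, theta#nu) is an infimum over couplings of a cost that is merely
    Borel, so as a function of theta it need not be Borel; and a sum of
    non-measurable functions need not be integrated additively by [\int], which is
    then a lower integral. The pointwise quasi-triangle inequality alone is
    therefore not enough to conclude.

    Pointwise: couplings of (rho, eta) and (eta, xi) are glued over their common
    marginal, and d1 satisfies its quasi-triangle inequality under the glued law.
    Both couplings are realised as laws of (q(Y, U), Y) with U uniform, q(y, .)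
    being the quantile function of the conditional law, whose distribution
    function at the rationals is a Radon-Nikodym derivative.

    In theta: every probability on R^2 is the law of Phi(x, U) for one fixed Borel
    map Phi and some bit stream x. Hence {theta | D_fgw < a} is the projection of a
    measurable set along the space of bit streams, i.e. a Souslin set, and Souslin
    sets are sandwiched between measurable sets of equal measure (Lusin; the proof
    is Choquet's capacitability argument). So D_fgw is squeezed between two Borel
    functions of theta that agree almost everywhere, which restores additivity. *)

(** * Souslin sets are universally measurable *)

Lemma seq_dependent_choice (P : seq nat -> Prop) :
  P [::] -> (forall s, P s -> exists v, P (rcons s v)) ->
  exists y : nat -> nat, forall n, P (mkseq y n).
Proof.
move=> P0 Prec.
have [f fP] : exists f : seq nat -> nat, forall s, P s -> P (rcons s (f s)).
  have H s : exists v, P s -> P (rcons s v).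
    have [Ps|nPs] := pselect (P s); last by exists 0%N.
    by have [v Pv] := Prec _ Ps; exists v.
  by have [f fP] := choice H; exists f.
pose s_ := fix s_ n := if n is m.+1 then rcons (s_ m) (f (s_ m)) else [::].
exists (fun n => f (s_ n)) => n.
have -> : mkseq (fun n => f (s_ n)) n = s_ n.
  by elim: n => // n IH; rewrite mkseqS IH.
by elim: n => //= n IH; exact: fP.
Qed.

(** The bound [m] makes the tree of prefixes finitely branching: a prefix shared by [y_ k] for
    arbitrarily large [k] extends by some value [v] with the same property. *)
Lemma konig_bounded (m : nat -> nat) (y_ : nat -> nat -> nat) :
  (forall k i, (i < k)%N -> (y_ k i <= m i)%N) ->
  exists y : nat -> nat, forall K, exists2 k, (K <= k)%N &
    forall i, (i < K)%N -> y_ k i = y i.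
Proof.
move=> ym.
pose P s := forall K, exists2 k, (K <= k)%N &
  forall i, (i < size s)%N -> y_ k i = nth 0%N s i.
have [||y yP] := @seq_dependent_choice P.
- by move=> K; exists K.
- move=> s Ps; apply: contrapT => /forallNP nP.
  have H v : exists K, forall k, (K <= k)%N ->
      (forall i, (i < size s)%N -> y_ k i = nth 0%N s i) -> y_ k (size s) <> v.
    have /existsNP[K HK] := nP v; exists K => k Kk Hs yv; apply: HK.
    exists k => // i; rewrite size_rcons nth_rcons ltnS leq_eqVlt => /predU1P[->|il].
      by rewrite ltnn eqxx.
    by rewrite il; exact: Hs.
  have [K_ K_P] := choice H.
  (* [K] lies beyond the threshold of each of the finitely many admissible values, and beyond
     [size s] so that the bound [ym] applies to the new coordinate. *)
  pose K := (\max_(v < (m (size s)).+1) K_ v + (size s).+1)%N.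
  have [k Kk Hk] := Ps K.
  have sk : (size s < k)%N by rewrite (leq_trans _ Kk)// leq_addl.
  have mv := ym _ _ sk.
  apply: (K_P (y_ k (size s)) k) => //.
  apply: leq_trans Kk; rewrite (leq_trans _ (leq_addr _ _))//.
  rewrite -[X in K_ X]/(val (Ordinal (mv : (_ < (m (size s)).+1)%N))).
  exact: leq_bigmax.
- exists y => K; have [k Kk Hk] := yP K K; exists k => // i iK.
  by rewrite Hk ?size_mkseq// nth_mkseq.
Qed.

Definition finitary {I A B : Type} (h : (nat -> I) -> (nat -> A) -> B) :=
  exists N : nat, forall x x' y y',
    (forall i, (i < N)%N -> x i = x' i) -> (forall i, (i < N)%N -> y i = y' i) ->
    h x y = h x' y'.

Section souslin.
Context d (T : measurableType d) (R : realType).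
Variable ell : {finite_measure set T -> \bar R}.

(* The outer measure of [E] exceeds [a]; since [ell] is finite the infimum defining
   the outer measure is attained, so a strict bound over the supersets suffices. *)
Definition outer_gt (a : \bar R) (E : set T) :=
  forall B, measurable B -> E `<=` B -> (a < ell B)%E.

(** Continuity of the outer measure along increasing sets. If it failed, each [E n] would have a
    measurable hull of measure at most [a]; the intersections of the tails of these hulls increase,
    still contain [E n], and their union would have measure at most [a]. *)
Lemma outer_gt_bigcup a (E : nat -> set T) :
  nondecreasing_seq E -> outer_gt a (\bigcup_n E n) -> exists n, outer_gt a (E n).
Proof.
move=> ndE aE; apply: contrapT => /forallNP nE.
have H n : exists B, [/\ measurable B, E n `<=` B & (ell B <= a)%E].
  apply: contrapT => nB; apply: (nE n) => B mB EB.
  by rewrite ltNge; apply/negP => Ba; apply: nB; exists B.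
have [B_ B_P] := choice H.
pose C n := \bigcap_(m in [set m | (n <= m)%N]) B_ m.
have mC n : measurable (C n).
  by apply: bigcap_measurable => [|k _]; [exists n; exact: leqnn | by have [] := B_P k].
have ndC : nondecreasing_seq C.
  move=> n m nm; apply/subsetPset => t Ct k mk; apply: Ct.
  exact: leq_trans nm mk.
have mUC : measurable (\bigcup_n C n) by exact: bigcup_measurable.
have CE : \bigcup_n E n `<=` \bigcup_n C n.
  move=> t [n _ Et]; exists n => // k nk.
  have [_ + _] := B_P k; apply.
  by have /subsetPset := ndE _ _ nk; apply.
have := aE _ mUC CE; apply/negP; rewrite -leNgt.
have cv := nondecreasing_cvg_mu (mu := ell) mC mUC ndC.
rewrite -(cvg_lim _ cv)//; apply: lime_le; first by apply/cvg_ex; eexists; exact: cv.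
apply: nearW => n /=; have [mB _ Ba] := B_P n.
by apply: le_trans Ba; apply: le_measure; rewrite ?inE// => t; apply; exact: leqnn.
Qed.

(** A form of the Souslin operation. The number of coordinates of [y] that a condition reads is
    fixed independently of [y], so finitely many conditions amount to a countable union over finite
    sequences. *)
Definition souslin (S : set T) := exists H : nat -> (nat -> nat) -> set T,
  [/\ forall n y, measurable (H n y),
      forall n, exists N, forall y y',
        (forall i, (i < N)%N -> y i = y' i) -> H n y = H n y' &
      S = [set t | exists y, forall n, H n y t]].

(* Choquet: bound the coordinates of [y] one at a time by [m] without losing outer
   measure; by Koenig's lemma the measurable sets [B k], which only see the first
   [k] coordinates, decrease to a subset of [S]. *)
Lemma souslin_inner (a : \bar R) (S : set T) : souslin S -> outer_gt a S ->
  exists A, [/\ measurable A, A `<=` S & (a <= ell A)%E].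
Proof.
move=> [H [mH fH SE]] aS.
have [N NP] := choice fH.
pose E (s : seq nat) := [set t | exists y,
  (forall i, (i < size s)%N -> (y i <= nth 0 s i)%N) /\ forall n, H n y t].
have [||m mP] := @seq_dependent_choice (fun s => outer_gt a (E s)).
- move=> B mB EB; apply: aS => // t; rewrite SE => -[y Hy].
  by apply: EB; exists y.
- move=> s aE; apply: outer_gt_bigcup.
    move=> v w vw; apply/subsetPset => t [y [ys Hy]]; exists y; split=> // i.
    move=> il; move: (ys i); rewrite !size_rcons !nth_rcons in il * => /(_ il).
    by case: ifP => // _; case: ifP => // _ /leq_trans; apply.
  move=> B mB EB; apply: aE => // t [y [ys Hy]]; apply: EB; exists (y (size s)) => //.
  exists y; split=> // i; rewrite size_rcons nth_rcons ltnS leq_eqVlt.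
  by move=> /predU1P[->|il]; [rewrite ltnn eqxx | rewrite il; exact: ys].
pose B k := [set t | exists y, (forall i, (i < k)%N -> (y i <= m i)%N) /\
  forall n, (n < k)%N -> (N n <= k)%N -> H n y t].
have mB k : measurable (B k).
  pose D := [set s : seq nat | forall i, (i < k)%N -> (nth 0 s i <= m i)%N].
  (* The constraint [N n <= k] lets a finite sequence replace [y], which turns an uncountable union
     into a countable one. *)
  have -> : B k = \bigcup_(s in D) \bigcap_(n in [set n | (n < k)%N /\ (N n <= k)%N])
      H n (nth 0%N s).
    apply/seteqP; split=> [t [y [ym Hy]]|t [s Ds Hs]].
      exists (mkseq y k) => [i ik|n [nk Nk]]; first by rewrite nth_mkseq// ym.
      rewrite (NP n _ y) => [|i iN]; first exact: Hy.
      by rewrite nth_mkseq// (leq_trans iN).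
    by exists (nth 0%N s); split=> // n nk Nk; exact: Hs.
  rewrite bigcup_mkcond; apply: countable_bigcupT_measurable => [|s].
    exact: countableP.
  case: ifPn => // _; apply: bigcap_measurableType => n _; exact: mH.
have niB : nonincreasing_seq B.
  move=> k l kl; apply/subsetPset => t [y [ym Hy]]; exists y; split=> [i ik|n nk Nk].
    by rewrite ym// (leq_trans ik).
  by apply: Hy; exact: leq_trans kl.
have EB k : E (mkseq m k) `<=` B k.
  move=> t [y [ym Hy]]; exists y; split=> // i ik.
  by have := ym i; rewrite size_mkseq nth_mkseq//; apply.
have mIB : measurable (\bigcap_k B k) by exact: bigcapT_measurable.
exists (\bigcap_k B k); split=> //.
  move=> t Bt; rewrite SE.
  (* Each [k] gives a witness bounded by [m] on its first [k] coordinates. A Koenig limit of these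
     witnesses agrees with some late [y_ k] on any prescribed prefix, hence satisfies every
     condition. *)
  have [y_ y_P] : exists y_ : nat -> nat -> nat, forall k,
      (forall i, (i < k)%N -> (y_ k i <= m i)%N) /\
      forall n, (n < k)%N -> (N n <= k)%N -> H n (y_ k) t.
    have [k|y_ y_P] := @choice _ _ (fun k y => (forall i, (i < k)%N -> (y i <= m i)%N) /\
      forall n, (n < k)%N -> (N n <= k)%N -> H n y t).
      exact: (Bt k).
    by exists y_.
  have [y yP] := konig_bounded (fun k => (y_P k).1).
  exists y => n; have [k Kk yk] := yP (maxn n.+1 (N n)).
  rewrite (NP n _ (y_ k)) => [|i iN]; last by rewrite yk// leq_max iN orbT.
  apply: (y_P k).2; first by rewrite (leq_trans _ Kk)// leq_maxl.
  by rewrite (leq_trans _ Kk)// leq_maxr.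
have cv : ell \o B @ \oo --> ell (\bigcap_n B n).
  apply: nonincreasing_cvg_mu => //.
  by rewrite -ge0_fin_numE ?measure_ge0// fin_num_measure.
rewrite -(cvg_lim _ cv)//; apply: lime_ge; first by apply/cvg_ex; eexists; exact: cv.
by apply: nearW => k; apply/ltW/(mP k).
Qed.

(** With [ereal_inf O] the outer measure of [S], hulls [B_ n] come from the infimum and measurable
    subsets [A_ n] from [souslin_inner]. Each misses the outer measure by at most [n.+1%:R^-1], so
    the gap between them is at most [2 / n.+1%:R]. *)
Theorem souslin_measurable (S : set T) : souslin S -> exists A B,
  [/\ measurable A, measurable B, A `<=` S, S `<=` B & ell (B `\` A) = 0%E].
Proof.
move=> sS.
pose O := [set ell B | B in [set B | measurable B /\ S `<=` B]].
have O0 x : O x -> (0 <= x)%E by move=> [B _ <-].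
have Ofin : ereal_inf O \is a fin_num.
  rewrite ge0_fin_numE; last by apply/ereal_infP => x /O0.
  apply: (@le_lt_trans _ _ (ell setT)).
    by apply: ereal_inf_lbound; exists setT.
  by rewrite -ge0_fin_numE ?measure_ge0// fin_num_measure.
have HB n : exists B, [/\ measurable B, S `<=` B &
    (ell B <= ereal_inf O + (n.+1%:R^-1)%R%:E)%E].
  have [] := @lb_ereal_inf_adherent R O n.+1%:R^-1 _ Ofin => //.
  by move=> x [B [mB SB] <-] /ltW lx; exists B.
have HA n : exists A, [/\ measurable A, A `<=` S &
    (ereal_inf O - (n.+1%:R^-1)%R%:E <= ell A)%E].
  apply: souslin_inner => // B mB SB.
  apply: (@lt_le_trans _ _ (ereal_inf O)); last by apply: ereal_inf_lbound; exists B.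
  by rewrite lteBlDr// lteDl// lte_fin invr_gt0.
have [B_ B_P] := choice HB; have [A_ A_P] := choice HA.
have mA : measurable (\bigcup_n A_ n) by apply: bigcupT_measurable => n; have [] := A_P n.
have mB : measurable (\bigcap_n B_ n) by apply: bigcapT_measurable => n; have [] := B_P n.
exists (\bigcup_n A_ n), (\bigcap_n B_ n); split=> //.
- by move=> t [n _]; have [_ + _] := A_P n; apply.
- by move=> t St n _; have [_ + _] := B_P n; apply.
apply/eqP; rewrite eq_le measure_ge0 andbT.
have le2 n : (ell (\bigcap_n B_ n `\` \bigcup_n A_ n) <= (2 / n.+1%:R)%R%:E)%E.
  have [mAn ASn An] := A_P n; have [mBn SBn Bn] := B_P n.
  apply: (@le_trans _ _ (ell (B_ n `\` A_ n))).
    apply: le_measure; rewrite ?inE; [exact: measurableD|exact: measurableD|].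
    by move=> t [Bt At]; split; [exact: Bt|move=> At'; apply: At; exists n].
  have AB : A_ n `<=` B_ n by exact: subset_trans ASn SBn.
  rewrite measureD// ?setIidr//; last by rewrite -ge0_fin_numE ?measure_ge0// fin_num_measure.
  rewrite leeBlDr ?fin_num_measure//; apply: le_trans Bn _.
  have [u uE] : exists u : R, ell (A_ n) = u%:E.
    by exists (fine (ell (A_ n))); rewrite fineK// fin_num_measure.
  have [v vE] : exists v : R, ereal_inf O = v%:E.
    by exists (fine (ereal_inf O)); rewrite fineK.
  rewrite -[X in (_ <= _ + X)%E]/(ell (A_ n)) uE vE in An *; rewrite -EFinB lee_fin in An.
  rewrite -!EFinD lee_fin.
  move: (n.+1%:R^-1 : R) An => w An; clear -An; lra.
apply/lee_addgt0Pr => e e0; rewrite add0e.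
apply: le_trans (le2 (Num.truncn (2 / e))) _.
rewrite lee_fin ler_pdivrMr// mulrC -ler_pdivrMr//.
exact/ltW/truncnS_gt.
Qed.
End souslin.

(** * Projections of measurable sets along bit streams *)

Section analytic.
Context d (T : measurableType d).

(** Each condition reads only finitely many bits of the second component, so that a projection can
    absorb the bit stream into [y]. *)
Definition analytic (E : set (T * (nat -> bool))) :=
  exists H : nat -> (nat -> bool) -> (nat -> nat) -> set T,
  [/\ forall n x y, measurable (H n x y),
      forall n, finitary (H n) &
      E = [set p | exists y, forall n, H n p.2 y p.1]].

Lemma analytic_fst (A : set T) : measurable A -> analytic (fst @^-1` A).
Proof.
move=> mA; exists (fun _ _ _ => A); split=> //; first by exists 0%N.
by apply/seteqP; split=> [p Ap|p [y]]; [exists (fun=> 0%N) | apply; exact: 0%N].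
Qed.

Lemma analytic_bit n b : analytic [set p | p.2 n = b].
Proof.
exists (fun _ x _ => if x n == b then setT else set0); split=> [_ x _|_|].
- by case: ifP.
- by exists n.+1 => x x' y y' xx' _; rewrite xx'.
- apply/seteqP; split=> [p /= ->|p [y /(_ 0%N)]/=]; first by exists (fun=> 0%N) => _; rewrite eqxx.
  by case: eqP.
Qed.

Lemma analytic_bigcap (E : nat -> set (T * (nat -> bool))) :
  (forall i, analytic (E i)) -> analytic (\bigcap_i E i).
Proof.
move=> aE; have [H HP] := choice aE.
(* One stream [y] carries a witness for every member: member [i] reads the positions
   [pickle (i, j)]. Indices that are not codes impose nothing. *)
pose K n x y := if @unpickle (nat * nat)%type n is Some (i, m)
  then H i m x (fun j => y (pickle (i, j))) else setT.
exists K; split=> [n x y|n|].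
- by rewrite /K; case: unpickle => [[i m]|//]; have [] := HP i.
- rewrite /K; case: unpickle => [[i m]|]; last by exists 0%N.
  have [_ /(_ m)[N NP] _] := HP i.
  exists (N + \max_(j < N) (pickle (i, val j)).+1)%N => x x' y y' xx' yy'.
  apply: NP => j jN; first by rewrite xx'// ltn_addr.
  apply: yy'; rewrite ltn_addl//.
  exact: (@leq_bigmax _ (fun j : 'I_N => (pickle (i, val j)).+1) (Ordinal jN)).
- apply/seteqP; split=> [p Ep|p [y yP] i _]; last first.
    have [_ _ ->] := HP i; exists (fun j => y (pickle (i, j))) => m.
    by have := yP (pickle (i, m)); rewrite /K pickleK.
  have [i|y_ y_P] := @choice _ _ (fun i y => forall n, H i n p.2 y p.1).
    by have := Ep i Logic.I; have [_ _ {1}->] := HP i.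
  exists (fun n => if @unpickle (nat * nat)%type n is Some (i, j) then y_ i j else 0%N) => n.
  rewrite /K; case: unpickle => [[i m]|//].
  by under [X in H _ _ _ X]eq_fun do rewrite pickleK.
Qed.

Lemma analytic_bigcup (E : nat -> set (T * (nat -> bool))) :
  (forall i, analytic (E i)) -> analytic (\bigcup_i E i).
Proof.
move=> aE; have [H HP] := choice aE.
(* [y 0] selects the member of the union. Conditions about the other members are
   void, which keeps the number of inspected coordinates independent of [y]. *)
pose K n x y := if @unpickle (nat * nat)%type n is Some (i, m)
  then if y 0%N == i then H i m x (fun j => y j.+1) else setT else setT.
exists K; split=> [n x y|n|].
- by rewrite /K; case: unpickle => [[i m]|//]; case: ifP => // _; have [] := HP i.
- rewrite /K; case: unpickle => [[i m]|]; last by exists 0%N.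
  have [_ /(_ m)[N NP] _] := HP i.
  exists N.+1 => x x' y y' xx' yy'; rewrite yy'//.
  case: ifP => // _; apply: NP => j jN; first by rewrite xx'// ltnW.
  exact: yy'.
- apply/seteqP; split=> [p [i _]|p [y yP]].
    have [_ _ ->] := HP i => -[y yP].
    exists (fun j => if j is k.+1 then y k else i) => n.
    rewrite /K; case: unpickle => [[i' m]|//].
    by case: eqP => // <-; exact: yP.
  exists (y 0%N) => //; have [_ _ ->] := HP (y 0%N); exists (fun j => y j.+1) => m.
  by have := yP (pickle (y 0%N, m)); rewrite /K pickleK eqxx.
Qed.

Definition bit_cylinders : set (set (nat -> bool)) :=
  [set [set x : nat -> bool | x n] | n in setT].

(** Imposing the condition on the complement as well yields a sigma-algebra; it contains the
    generators of the product, hence every measurable set. *)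
Definition bianalytic (E : set (T * (nat -> bool))) := analytic E /\ analytic (~` E).

Lemma sigma_algebra_bianalytic : sigma_algebra setT bianalytic.
Proof.
split.
- split; last by rewrite setC0 -(preimage_setT fst); exact: analytic_fst.
  by rewrite -(preimage_set0 fst); exact: analytic_fst.
- by move=> E [E1 E2]; rewrite setTD; split => //; rewrite setCK.
- move=> E aE; split; first by apply: analytic_bigcup => i; have [] := aE i.
  by rewrite setC_bigcup; apply: analytic_bigcap => i; have [] := aE i.
Qed.

Lemma measurable_analytic (E : set (T * g_sigma_algebraType bit_cylinders)) :
  measurable E -> analytic E.
Proof.
suff sb : (@measurable _ (T * g_sigma_algebraType bit_cylinders)%type) `<=` bianalytic.
  by move=> /sb[].
apply: smallest_sub; first exact: sigma_algebra_bianalytic.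
rewrite subUset; split=> [_ [A mA <-]|_ [B mB <-]]; rewrite setTI.
  split; first exact: analytic_fst.
  by rewrite preimage_setC; apply: analytic_fst; exact: measurableC.
suff : <<s bit_cylinders >> `<=` [set B | bianalytic (snd @^-1` B)] by apply.
have [b0 bC bU] := sigma_algebra_bianalytic.
apply: smallest_sub.
  split; first by rewrite /= preimage_set0.
  - by move=> A bA; rewrite setTD /= -preimage_setC -setTD; exact: bC.
  - by move=> A bA; rewrite /= preimage_bigcup; exact: bU.
move=> _ [n _ <-]; split; first exact: (analytic_bit n true).
rewrite (_ : ~` _ = [set p : T * (nat -> bool) | p.2 n = false]); first exact: analytic_bit.
by apply/seteqP; split=> p /=; case: (p.2 n).
Qed.

Lemma souslin_projection (E : set (T * g_sigma_algebraType bit_cylinders)) :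
  measurable E -> souslin [set t | exists x, E (t, x)].
Proof.
move=> /measurable_analytic[H [mH fH EE]].
(* A single stream of integers encodes both witnesses: parities at even positions give the bits, odd
   positions give the auxiliary stream. *)
pose dx (y : nat -> nat) n := odd (y n.*2); pose dy (y : nat -> nat) n := y n.*2.+1.
exists (fun n y => H n (dx y) (dy y)); split=> [n y|n|]; first exact: mH.
  have [N NP] := fH n; exists N.*2.+1 => y y' yy'; apply: NP => i iN.
    by rewrite /dx yy'// ltnS leq_double ltnW.
  by rewrite /dy yy'// ltnS ltn_double.
apply/seteqP; split=> [t [x]|t [y Hy]].
  rewrite EE => -[y /= Hy].
  pose z n := if odd n then y n./2 else nat_of_bool (x n./2).
  have zx : dx z = x.
    by apply/funext => i; rewrite /dx/z odd_double doubleK oddb.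
  have zy : dy z = y.
    by apply/funext => i; rewrite /dy/z /= odd_double uphalf_double.
  by exists z => n; rewrite zx zy; exact: Hy.
exists (dx y); rewrite EE; exists (dy y); exact: Hy.
Qed.

End analytic.

(** * Coding reals and pairs of reals *)

Section real_codes.
Context {R : realType}.

Definition ratseq (n : nat) : R := ratr (odflt 0 (@unpickle rat n)).

Lemma ratseq_dense (x y : R) : x < y -> exists n, x < ratseq n < y.
Proof.
move=> /rat_in_itvoo[r]; rewrite in_itv/= => xy.
by exists (pickle r); rewrite /ratseq pickleK.
Qed.

(* [b] marks the rationals of the lower half of a Dedekind cut. *)
Definition cut_value (b : nat -> bool) : R :=
  fine (esups (fun n => if b n then (ratseq n)%:E else -oo%E) 0%N).

Lemma cut_valueK (x : R) : cut_value (fun n => ratseq n < x) = x.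
Proof.
rewrite /cut_value /esups/= (_ : ereal_sup _ = x%:E)//; apply/eqP; rewrite eq_le.
apply/andP; split.
  apply: ub_ereal_sup => _ [n _ <-]; case: ifP => // qx; last by rewrite leNye.
  by rewrite lee_fin ltW.
apply/lee_subgt0Pr => e e0.
have [|n /andP[qn1 qn2]] := @ratseq_dense (x - e) x; first by rewrite gtrBl.
apply: ereal_sup_ge; exists (ratseq n)%:E; last by rewrite -EFinB lee_fin ltW.
by exists n => //=; rewrite qn2.
Qed.

Lemma measurable_cut_value d (T : measurableType d) (b : nat -> T -> bool) :
  (forall n, measurable_fun setT (b n)) ->
  measurable_fun setT (fun t => cut_value (b ^~ t)).
Proof.
move=> mb; rewrite /cut_value; apply: (@measurableT_comp _ _ _ _ _ _ fine) => //.
apply: (@measurable_fun_esups _ _ _ _ (fun n t => if b n t then (ratseq n)%:E else -oo%E)).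
move=> n; exact: measurable_fun_ifT.
Qed.

(* Bits become the ternary digits 0 and 2, so that no two streams collide. *)
Definition ternary (e : nat -> bool) : \bar R :=
  (\sum_(n <oo) ((e n)%:R * 2 / 3 ^+ n.+1)%:E)%E.

Let tern_ge0 (e : nat -> bool) n : (0 <= ((e n)%:R * 2 / 3 ^+ n.+1 : R)%:E)%E.
Proof. by rewrite lee_fin divr_ge0// mulr_ge0. Qed.

Lemma ternary_ge0 e : (0 <= ternary e)%E.
Proof. by apply: nneseries_ge0 => n _ _; exact: tern_ge0. Qed.

Lemma ternary_le1 e : (ternary e <= 1)%E.
Proof.
apply: lime_le; first by apply: is_cvg_nneseries => n _ _; exact: tern_ge0.
apply: nearW => n; rewrite sumEFin lee_fin.
suff : \sum_(0 <= i < n) ((e i)%:R * 2 / 3 ^+ i.+1) <= 1 - 3 ^- n :> R.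
  by move=> /le_trans; apply; rewrite gerBl invr_ge0 exprn_ge0.
elim: n => [|n IH]; first by rewrite big_geq// expr0 invr1 subrr.
rewrite big_nat_recr//=; apply: le_trans (lerD IH _) _.
  apply: (@le_trans _ _ (2 / 3 ^+ n.+1)); last exact: lexx.
  by rewrite ler_pM2r ?invr_gt0 ?exprn_gt0// ler_piMl// lern1 leq_b1.
by rewrite exprS invfM; move: (3 ^- n) => r; lra.
Qed.

Lemma ternary_rec e :
  ternary e = (((e 0%N)%:R * 2 / 3)%:E + (3^-1)%:E * ternary (fun n => e n.+1))%E.
Proof.
rewrite {1}/ternary nneseries_recl//.
rewrite expr1; congr (_ + _)%E; rewrite /ternary -nneseriesZl; last first.
  by move=> k _; exact: (tern_ge0 (fun n => e n.+1)).
rewrite -(@nneseries_addn _ _ 1); last by move=> k; exact: tern_ge0.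
apply: eq_eseriesr => n _; rewrite addn1 -EFinM; congr EFin.
by rewrite [3 ^+ n.+2]exprS invfM; ring.
Qed.

(** On values of [ternary] the threshold separates the leading digits: digit 0 leaves at most 1/3,
    digit 2 gives at least 2/3. The shift triples and drops that digit. *)
Definition trit (z : R) : bool := 2^-1 <= z.
Definition tern_shift (z : R) : R := 3 * z - (trit z)%:R * 2.

Lemma trit_ternary e n : trit (iter n tern_shift (fine (ternary e))) = e n.
Proof.
have fin e' : ternary e' \is a fin_num.
  by rewrite ge0_fin_numE ?ternary_ge0// (le_lt_trans (ternary_le1 e'))// ltry.
have ge0 e' : 0 <= fine (ternary e') by rewrite fine_ge0// ternary_ge0.
have le1 e' : fine (ternary e') <= 1 by rewrite -lee_fin fineK// ternary_le1.
have recE e' : fine (ternary e') = (e' 0%N)%:R * 2 / 3 + 3^-1 * fine (ternary (fun n => e' n.+1)).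
  by apply: EFin_inj; rewrite EFinD [X in (_ + X)%E]EFinM !fineK// -ternary_rec.
have trit0 e' : trit (fine (ternary e')) = e' 0%N.
  rewrite /trit recE; have := ge0 (fun n => e' n.+1); have := le1 (fun n => e' n.+1).
  move: (fine _) => r; case: (e' 0%N) => /= r1 r0; [|apply/negbTE; rewrite -ltNge]; lra.
elim: n e => [|n IH] e; first exact: trit0.
rewrite iterSr -(IH (fun n => e n.+1)); congr (trit (iter _ _ _)).
by rewrite /tern_shift trit0 recE; lra.
Qed.

Lemma measurable_trit n : measurable_fun setT (fun z => trit (iter n tern_shift z)).
Proof.
have mtrit d (T : measurableType d) (f : T -> R) : measurable_fun setT f ->
    measurable_fun setT (fun z => trit (f z)).
  by move=> mf; apply: measurable_fun_ler.
apply: (mtrit); elim: n => [|n IH]/=; first exact: measurable_id.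
apply: measurable_funB; first exact: measurable_funM.
rewrite (_ : (fun z => _) = (fun z => if trit (iter n tern_shift z) then 2 else 0)).
  by apply: measurable_fun_ifT => //; exact: mtrit.
by apply/funext => z; case: trit; rewrite ?mul1r ?mul0r.
Qed.

(** Interleaving the two Dedekind cuts codes a point of the plane as one real, so that
    one-dimensional quantiles also serve laws on the plane. *)
Definition pair_bits (p : R * R) (n : nat) : bool :=
  ratseq n./2 < if odd n then p.2 else p.1.
Definition pair_code (p : R * R) : R := fine (ternary (pair_bits p)).
Definition pair_decode (z : R) : R * R :=
  (cut_value (fun n => trit (iter n.*2 tern_shift z)),
   cut_value (fun n => trit (iter n.*2.+1 tern_shift z))).

Lemma pair_codeK : cancel pair_code pair_decode.
Proof.
move=> [x y]; rewrite /pair_decode /pair_code.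
under [X in cut_value X]eq_fun do rewrite trit_ternary /pair_bits odd_double doubleK.
under [X in (_, cut_value X)]eq_fun do rewrite trit_ternary /pair_bits/= odd_double uphalf_double.
by rewrite !cut_valueK.
Qed.

Lemma measurable_pair_code : measurable_fun setT pair_code.
Proof.
rewrite /pair_code; apply: (@measurableT_comp _ _ _ _ _ _ fine) => //.
apply: ge0_emeasurable_sum => n.
  by move=> p _ _; exact: tern_ge0.
move=> _; rewrite (_ : (fun p => _) = (fun p => if pair_bits p n then
    (2 / 3 ^+ n.+1)%:E else 0%E)); last first.
  by apply/funext => p; case: pair_bits; rewrite ?mul1r ?mul0r.
apply: measurable_fun_ifT => //; apply: measurable_fun_ltr => //.
by case: (odd n); [exact: measurable_snd|exact: measurable_fst].
Qed.

Lemma measurable_pair_decode : measurable_fun setT pair_decode.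
Proof.
by apply: measurable_fun_pair; apply: measurable_cut_value => n; exact: measurable_trit.
Qed.

End real_codes.

(** * Quantile functions *)

Section quantile.
Context {R : realType}.
Local Notation ratseq := (@ratseq R).

Definition lam : probability (measurableTypeR R) R := uniform_prob (@ltr01 R).

Lemma lamE (U : set R) : measurable U -> U `<=` `[0, 1]%classic ->
  lam U = lebesgue_measure U.
Proof.
move=> mU U01; rewrite /lam /= /uniform_prob.
rewrite (eq_integral (cst 1%E)); first by rewrite integral_cst// mul1e.
move=> x; rewrite inE => /U01/=; rewrite in_itv/= /uniform_pdf => ->.
by rewrite subr0 invr1.
Qed.

Lemma lam_oo : lam `]0, 1[%classic = 1%E.
Proof.
rewrite lamE//; first by rewrite lebesgue_measure_itv/= lte_fin ltr01 oppr0 adde0.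
by apply: subset_itv; rewrite bnd_simp.
Qed.

Lemma lam_setI_oo (U : set R) : measurable U -> lam (U `&` `]0, 1[%classic) = lam U.
Proof.
move=> mU; have m01 : measurable (`]0, 1[%classic : set R) by exact: measurable_itv.
have l0 : lam (~` `]0, 1[%classic) = 0%E by rewrite probability_setC// lam_oo subee.
rewrite -[in RHS](setUIDK U `]0, 1[%classic) measureU//; first last.
- by rewrite setDE setIACA setICr setI0.
- exact: measurableD.
- exact: measurableI.
rewrite [X in (_ + X)%E](_ : _ = 0%E) ?adde0//.
apply/eqP; rewrite eq_le measure_ge0 andbT -l0; apply: le_measure; rewrite ?inE//.
- exact: measurableD.
- exact: measurableC.
Qed.

Lemma lam_le (c : R) : 0 <= c <= 1 -> lam [set u | u <= c] = c%:E.
Proof.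
move=> /andP[c0 c1].
have mc : measurable [set u : R | u <= c].
  by rewrite -set_itvNyc; exact: measurable_itv.
rewrite -lam_setI_oo//.
have [->|c1'] := eqVneq c 1.
  rewrite (_ : _ `&` _ = `]0, 1[%classic) ?lam_oo//.
  by apply/seteqP; split=> [x []//|x /[dup] x01 /=]; rewrite in_itv/= => /andP[_ /ltW].
have cl1 : c < 1 by rewrite lt_neqAle c1'.
rewrite (_ : _ `&` _ = `]0, c]%classic); last first.
  apply/seteqP; split=> [x [/= xc]|x/=]; rewrite !in_itv/= => /andP[x0 x1].
    by rewrite x0.
  by split=> //; rewrite x0 (le_lt_trans x1).
rewrite lamE//.
  rewrite lebesgue_measure_itv/= lte_fin oppr0 adde0.
  by move: c0; rewrite le_eqVlt => /predU1P[<-|->] //; rewrite ltxx.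
by apply: subset_itv; rewrite bnd_simp// ltW.
Qed.

(* For [cdf_like k] the infimum is finite, hence [fine] not junk, whenever [0 < u < 1]. *)
Definition quantile (k : nat -> R) (u : R) : R :=
  fine (einfs (fun n => if u <= k n then (ratseq n)%:E else +oo%E) 0%N).

Lemma measurable_quantile d (T : measurableType d) (k : nat -> T -> R) (u : T -> R) :
  (forall n, measurable_fun setT (k n)) -> measurable_fun setT u ->
  measurable_fun setT (fun t => quantile (k ^~ t) (u t)).
Proof.
move=> mk mu; rewrite /quantile; apply: (@measurableT_comp _ _ _ _ _ _ fine) => //.
apply: (@measurable_fun_einfs _ _ _ _
  (fun n t => if u t <= k n t then (ratseq n)%:E else +oo%E)) => n.
by apply: measurable_fun_ifT => //; exact: measurable_fun_ler.
Qed.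

(** The trace on the rationals of a distribution function, up to right continuity. This is why
    [lam_quantile_le] passes to a strictly larger rational; [ray_right] closes the gap later. *)
Definition cdf_like (k : nat -> R) :=
  [/\ forall n, 0 <= k n <= 1,
      forall m n, ratseq m <= ratseq n -> k m <= k n,
      forall e, 0 < e -> exists n, k n < e &
      forall e, 0 < e -> exists n, 1 - e < k n].

Section cdf_like.
Variables (k : nat -> R) (u : R).
Hypotheses (kc : cdf_like k) (u01 : 0 < u < 1).

Let I := einfs (fun n => if u <= k n then (ratseq n)%:E else +oo%E) 0%N.

Let I_le n : u <= k n -> (I <= (ratseq n)%:E)%E.
Proof. by move=> ukn; apply: ereal_inf_lbound; exists n => //=; rewrite ukn. Qed.

Let I_fin : I \is a fin_num.
Proof.
have [_ kmono kinf ksup] := kc; have /andP[u0 u1] := u01.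
rewrite fin_numE; apply/andP; split.
  have [n kn] := kinf _ u0.
  apply/eqP => INy; suff : ((ratseq n)%:E <= I)%E by rewrite INy leeNy_eq.
  apply/ereal_infP => _ [m _ <-]; case: ifPn; last by rewrite leey.
  move=> um; rewrite lee_fin leNgt; apply/negP => /ltW/kmono.
  by rewrite leNgt (lt_le_trans kn).
have [|n kn] := ksup (1 - u); first by rewrite subr_gt0.
rewrite lt_eqF// (@le_lt_trans _ _ (ratseq n)%:E)// ?ltry//.
by apply: I_le; move: kn; rewrite opprB addrC subrK => /ltW.
Qed.

Lemma quantile_le m : u <= k m -> quantile k u <= ratseq m.
Proof. by move=> /I_le; rewrite -(fineK I_fin). Qed.

Lemma quantile_lt n : quantile k u < ratseq n -> u <= k n.
Proof.
have [_ kmono _ _] := kc; rewrite -lte_fin fineK// => /ereal_inf_lt[_ [m _ <-]].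
case: ifPn => // um; rewrite lte_fin => /ltW/kmono.
exact: le_trans.
Qed.

End cdf_like.

Let m_q k (x : R) : measurable [set u | quantile k u <= x].
Proof.
rewrite -[X in measurable X]setTI; apply: measurable_fun_le => //.
by apply: (@measurable_quantile _ _ (fun n _ => k n)).
Qed.

Lemma lam_quantile_ge k m : cdf_like k ->
  ((k m)%:E <= lam [set u | (quantile k u <= ratseq m)%R])%E.
Proof.
move=> kc; have [k01 _ _ _] := kc.
rewrite -lam_le// -lam_setI_oo; last by rewrite -set_itvNyc; exact: measurable_itv.
apply: le_measure; rewrite ?inE.
- by apply: measurableI; [rewrite -set_itvNyc; exact: measurable_itv|exact: measurable_itv].
- exact: m_q.
- by move=> u [/= um]; rewrite in_itv/= => u01; exact: quantile_le.
Qed.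

Lemma lam_quantile_le k m n : cdf_like k -> ratseq m < ratseq n ->
  (lam [set u | (quantile k u <= ratseq m)%R] <= (k n)%:E)%E.
Proof.
move=> kc mn; have [k01 _ _ _] := kc.
rewrite -lam_le// -lam_setI_oo; last exact: m_q.
apply: le_measure; rewrite ?inE.
- by apply: measurableI; [exact: m_q | exact: measurable_itv].
- by rewrite -set_itvNyc; exact: measurable_itv.
- move=> u [/= um]; rewrite in_itv/= => u01; apply: (quantile_lt kc) => //.
  exact: le_lt_trans mn.
Qed.

End quantile.

(** * Disintegration on the real line *)

Lemma measurable_set_bool d (T : measurableType d) (b : T -> bool) :
  measurable_fun setT b -> measurable [set t | b t].
Proof.
by move=> mb; rewrite -[X in measurable X]setTI; exact: (mb measurableT [set true]).
Qed.

Section slice_measure.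
Context d1 d2 (S : measurableType d1) (T : measurableType d2) (R : realType).
Variables (p : probability (S * T)%type R) (B : set S) (mB : measurable B).

(** The measurability of [B] is an argument so that a measure structure can be attached to the
    function. *)
Definition slice_measure of measurable B := fun A : set T => p (B `*` A).
Local Notation nu := (slice_measure mB).

Let nu0 : nu set0 = 0%E.
Proof. by rewrite /slice_measure setX0 measure0. Qed.

Let nu_ge0 A : (0 <= nu A)%E.
Proof. exact: measure_ge0. Qed.

Let nu_sigma_additive : semi_sigma_additive nu.
Proof.
move=> F mF tF mUF; rewrite /slice_measure setX_bigcupr.
apply: measure_semi_sigma_additive => [i||].
- exact: measurableX.
- apply/trivIsetP => i j _ _ ij; rewrite -setXI.
  by move/trivIsetP : tF => ->//; rewrite setX0.
- by apply: bigcup_measurable => i _; exact: measurableX.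
Qed.

HB.instance Definition _ := isMeasure.Build _ _ _ nu nu0 nu_ge0 nu_sigma_additive.

Let nu_finite : fin_num_fun nu.
Proof. by move=> A mA; apply: fin_num_measure; exact: measurableX. Qed.

HB.instance Definition _ := Measure_isFinite.Build _ _ _ nu nu_finite.

End slice_measure.

Section ae_comparison.
Context d (T : measurableType d) (R : realType) (eta : probability T R).

(** Since the integral of [g] over [A] is finite it can be subtracted: [f - g] is positive on [A]
    with integral zero, which forces [A] to be null. *)
Lemma measure_gt_eq0 (f g : T -> R) (A := [set t | g t < f t]) :
  measurable_fun setT f -> measurable_fun setT g ->
  (forall t, 0 <= g t) ->
  (\int[eta]_(t in A) (g t)%:E < +oo)%E ->
  (\int[eta]_(t in A) (f t)%:E
   <= \int[eta]_(t in A) (g t)%:E)%E ->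
  eta A = 0%E.
Proof.
move=> mf mg g0 gfin fg.
have mA : measurable A.
  by apply: measurable_set_bool; exact: measurable_fun_ltr.
have mh : measurable_fun A (fun t => (f t - g t)%:E).
  by apply/measurable_EFinP; apply: measurable_funTS; exact: measurable_funB.
have h0 t : A t -> (0 <= (f t - g t)%:E)%E.
  by rewrite /A/= => gf; rewrite lee_fin subr_ge0 ltW.
have int0 : (\int[eta]_(t in A) (f t - g t)%:E = 0)%E.
  apply/eqP; rewrite eq_le integral_ge0// andbT.
  have fE : (\int[eta]_(t in A) (f t)%:E =
      \int[eta]_(t in A) (f t - g t)%:E + \int[eta]_(t in A) (g t)%:E)%E.
    rewrite -ge0_integralD//.
    - by apply: eq_integral => t _; rewrite -EFinD subrK.
    - by move=> t _; rewrite lee_fin.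
    - by apply/measurable_EFinP; exact: measurable_funTS.
  have gfn : (\int[eta]_(t in A) (g t)%:E)%E \is a fin_num.
    by rewrite ge0_fin_numE// integral_ge0// => t _; rewrite lee_fin.
  by move: fg; rewrite fE -leeBrDr// subee.
have : ae_eq eta A (fun t => (f t - g t)%:E) (cst 0%E).
  apply/ae_eq_integral_abs => //; rewrite -[RHS]int0.
  by apply: eq_integral => t; rewrite inE => At; rewrite gee0_abs// h0.
move=> [N [mN N0 AN]]; apply/eqP; rewrite eq_le measure_ge0 andbT -N0.
apply: le_measure; rewrite ?inE// => t At; apply: AN => /(_ At)/= [] /eqP.
by rewrite subr_eq0 gt_eqF.
Qed.

End ae_comparison.

Section finite_measure_continuity.
Context d (T : measurableType d) (R : realType).
Variable P : {finite_measure set T -> \bar R}.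
Variables (F : nat -> set T) (mF : forall i, measurable (F i)).

Let finP A : measurable A -> (P A < +oo)%E.
Proof. by move=> mA; rewrite -ge0_fin_numE ?measure_ge0// fin_num_measure. Qed.

Lemma nonincreasing_measure_lt (e : R) : nonincreasing_seq F -> 0 < e ->
  exists i, (P (F i) < P (\bigcap_i F i) + e%:E)%E.
Proof.
move=> niF e0; have mI : measurable (\bigcap_i F i) by exact: bigcapT_measurable.
apply: contrapT => /forallNP nF.
have cv := nonincreasing_cvg_mu (finP (mF 0%N)) mF mI niF.
have : (P (\bigcap_i F i) + e%:E <= P (\bigcap_i F i))%E.
  rewrite -[leRHS](cvg_lim _ cv)//; apply: lime_ge.
    by apply/cvg_ex; eexists; exact: cv.
  by apply: nearW => i; rewrite leNgt; apply/negP; exact: nF.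
by apply/negP; rewrite -ltNge lteDl ?lte_fin// fin_num_measure.
Qed.

Lemma nondecreasing_measure_lt (e : R) : nondecreasing_seq F -> 0 < e ->
  exists i, (P (\bigcup_i F i) < P (F i) + e%:E)%E.
Proof.
move=> ndF e0; have mU : measurable (\bigcup_i F i) by exact: bigcupT_measurable.
apply: contrapT => /forallNP nF.
have cv := nondecreasing_cvg_mu (mu := P) mF mU ndF.
have : (P (\bigcup_i F i) <= P (\bigcup_i F i) - e%:E)%E.
  rewrite -[leLHS](cvg_lim _ cv)//; apply: lime_le.
    by apply/cvg_ex; eexists; exact: cv.
  by apply: nearW => i; rewrite leeBrDr// leNgt; apply/negP; exact: nF.
by apply/negP; rewrite -ltNge lteBlDr// lteDl ?lte_fin// fin_num_measure.
Qed.

End finite_measure_continuity.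

Section disintegration.
Context d (T : measurableType d) (R : realType).
Variables (p : probability (R * T)%type R).
Local Notation ratseq := (@ratseq R).

Definition ray (n : nat) : set R := [set x | x <= ratseq n].

Lemma measurable_ray n : measurable (ray n).
Proof. by rewrite /ray -set_itvNyc; exact: measurable_itv. Qed.

Let mray n (A : set T) : measurable A -> measurable (ray n `*` A).
Proof. by move=> mA; apply: measurableX => //; exact: measurable_ray. Qed.

(** Rational rays come in the order of an enumeration, so continuity from above is applied to the
    rays at negative integers and a rational ray is then fitted inside one of them. *)
Lemma ray_lower e : 0 < e -> exists n, (p (ray n `*` setT) < e%:E)%E.
Proof.
move=> e0; pose F i := [set x : R | x <= - i%:R] `*` [set: T].
have mF i : measurable (F i).
  by apply: measurableX => //; rewrite -set_itvNyc; exact: measurable_itv.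
have [|i] := @nonincreasing_measure_lt _ _ _ p F mF e _ e0.
  move=> i j ij; apply/subsetPset => -[x t] [/= xj _]; split=> //=.
  by rewrite (le_trans xj)// lerN2 ler_nat.
rewrite (_ : \bigcap_i _ = set0) ?measure0 ?add0e; last first.
  rewrite -subset0 => -[x t] /(_ (Num.bound x) Logic.I)[/=].
  rewrite leNgt => /negP + _; apply; rewrite ltrNl.
  exact: ltrNbound.
have [|n /andP[_ ni]] := @ratseq_dense R (- i%:R - 1) (- i%:R); first by rewrite gtrBl.
move=> pF; exists n; apply: le_lt_trans pF; apply: le_measure; rewrite ?inE//.
- exact: mray.
- by move=> [x t] [/= xn _]; split=> //=; rewrite (le_trans xn)// ltW.
Qed.

Lemma ray_upper (A : set T) e : measurable A -> 0 < e ->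
  exists n, (p (setT `*` A) < p (ray n `*` A) + e%:E)%E.
Proof.
move=> mA e0; pose F i := [set x : R | x <= i%:R] `*` A.
have mF i : measurable (F i).
  by apply: measurableX => //; rewrite -set_itvNyc; exact: measurable_itv.
have [|i] := @nondecreasing_measure_lt _ _ _ p F mF e _ e0.
  move=> i j ij; apply/subsetPset => -[x t] [/= xj At]; split=> //=.
  by rewrite (le_trans xj)// ler_nat.
rewrite (_ : \bigcup_i _ = setT `*` A); last first.
  apply/seteqP; split=> [[x t] [j _ [_ At]]//|[x t] [_ /= At]].
  exists (Num.bound x) => //; split=> //=.
  by rewrite ltW// ltr_bound.
have [|n /andP[ni _]] := @ratseq_dense R i%:R (i%:R + 1); first by rewrite ltrDl.
move=> pF; exists n; apply: (lt_le_trans pF); rewrite leeD2r//.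
apply: le_measure; rewrite ?inE//; first exact: mray.
by move=> [x t] [/= xn At]; split=> //=; rewrite /ray/= (le_trans xn)// ltW.
Qed.

Lemma ray_right (A : set T) m e : measurable A -> 0 < e ->
  exists2 n, ratseq m < ratseq n & (p (ray n `*` A) < p (ray m `*` A) + e%:E)%E.
Proof.
move=> mA e0; pose F i := [set x : R | x <= ratseq m + i.+1%:R^-1] `*` A.
have mF i : measurable (F i).
  by apply: measurableX => //; rewrite -set_itvNyc; exact: measurable_itv.
have [|i] := @nonincreasing_measure_lt _ _ _ p F mF e _ e0.
  move=> i j ij; apply/subsetPset => -[x t] [/= xj At]; split=> //=.
  by rewrite (le_trans xj)// lerD2l lef_pV2 ?posrE// ler_nat.
rewrite (_ : \bigcap_i _ = ray m `*` A); last first.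
  apply/seteqP; split=> [[x t] Fx|[x t] [/= xm At] j _]; last first.
    by split=> //=; rewrite (le_trans xm)// lerDl invr_ge0.
  split=> /=; last by have [] := Fx 0%N Logic.I.
  apply/ler_addgt0Pr => r r0; have [/= + _] := Fx (Num.truncn r^-1) Logic.I.
  move=> /le_trans; apply; rewrite lerD2l -[leRHS]invrK lef_pV2 ?posrE ?invr_gt0//.
  exact/ltW/truncnS_gt.
have [|n /andP[mn ni]] := @ratseq_dense R (ratseq m) (ratseq m + i.+1%:R^-1).
  by rewrite ltrDl invr_gt0.
move=> pF; exists n => //; apply: le_lt_trans pF; apply: le_measure; rewrite ?inE//.
- exact: mray.
- by move=> [x t] [/= xn At]; split=> //=; rewrite (le_trans xn)// ltW.
Qed.

End disintegration.

Arguments ray {R} n.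
Arguments measurable_ray {R} n.

Section disintegration.
Context d (T : measurableType d) (R : realType).
Variables (p : probability (R * T)%type R) (eta : probability T R).
Hypothesis pT : forall A, measurable A -> p (setT `*` A) = eta A.
Local Notation ratseq := (@ratseq R).

Let mray n (A : set T) : measurable A -> measurable (@ray R n `*` A).
Proof. by move=> mA; apply: measurableX => //; exact: measurable_ray. Qed.

Let p_ray_le n (A : set T) : measurable A -> (p (ray n `*` A) <= eta A)%E.
Proof.
move=> mA; rewrite -pT//; apply: le_measure; rewrite ?inE//; first exact: mray.
  exact: measurableX.
by move=> [x t] [].
Qed.

Let density n : exists k : T -> R, [/\ measurable_fun setT k, forall t, 0 <= k t &
  forall A, measurable A -> p (ray n `*` A) = (\int[eta]_(t in A) (k t)%:E)%E].
Proof.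
have dom : slice_measure p (measurable_ray n) `<< eta.
  apply/null_content_dominatesP => A mA A0.
  by apply/eqP; rewrite eq_le measure_ge0 andbT -A0; exact: p_ray_le.
have [f [f0 ffin fint fE]] := radon_nikodym_sigma_finite dom.
exists (fine \o f); split=> [|t|A mA].
- by apply: measurableT_comp => //; case/integrableP : fint.
- exact: fine_ge0.
- rewrite -[LHS]/(slice_measure p (measurable_ray n) A) fE//.
  by apply: eq_integral => t _ /=; rewrite fineK.
Qed.

(** Radon-Nikodym densities satisfy each requirement of [cdf_like] only almost everywhere. The
    requirements reduce to countably many, so the exceptional sets lie in one null set [N], on which
    the kernel is redefined. *)
Theorem disintegration : exists k : nat -> T -> R,
  [/\ forall n, measurable_fun setT (k n),
      forall t, cdf_like (k ^~ t) &
      forall n A, measurable A ->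
        p (ray n `*` A) = (\int[eta]_(t in A) (k n t)%:E)%E].
Proof.
have [k0 /all_and3[mk k_ge0 kE]] := choice density.
have kfin n A : measurable A -> (\int[eta]_(t in A) (k0 n t)%:E < +oo)%E.
  by move=> mA; rewrite -kE// (le_lt_trans (probability_le1 _ _))// ?ltry//; exact: mray.
(* Failures of monotonicity, of the bound by 1, of the limit 0 at the left and of the limit 1 at the
   right; [e_] makes the last two countable. *)
pose B1 (m n : nat) := if ratseq m <= ratseq n then [set t | k0 n t < k0 m t] else set0.
pose B2 n := [set t | 1 < k0 n t].
pose e_ (j : nat) : R := j.+1%:R^-1.
have e_gt0 j : 0 < e_ j by rewrite invr_gt0.
pose B3 j := \bigcap_n [set t | e_ j <= k0 n t].
pose B4 j := \bigcap_n [set t | k0 n t <= 1 - e_ j].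
have N1 m n : eta.-negligible (B1 m n).
  rewrite /B1; case: ifPn => mn; last exact: negligible_set0.
  have mA : measurable [set t | k0 n t < k0 m t].
    by apply: measurable_set_bool; exact: measurable_fun_ltr.
  exists [set t | k0 n t < k0 m t]; split=> //.
  apply: measure_gt_eq0 => //; first exact: kfin.
  rewrite -!kE//; apply: le_measure; rewrite ?inE//; [exact: mray|exact: mray|].
  by move=> [x t] [/= xm At]; split=> //=; exact: le_trans mn.
have N2 n : eta.-negligible (B2 n).
  have mA : measurable (B2 n) by apply: measurable_set_bool; exact: measurable_fun_ltr.
  have i1 : (\int[eta]_(t in B2 n) 1%:E)%E = eta (B2 n) by rewrite integral_cst// mul1e.
  exists (B2 n); split=> //; apply: (@measure_gt_eq0 _ _ _ _ (k0 n) (cst 1)) => //.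
    by rewrite i1 (le_lt_trans (probability_le1 _ _))// ltry.
  by rewrite i1 -kE//; exact: p_ray_le.
have small (b e : R) : 0 <= b -> 0 < e -> (forall r : R, 0 < r -> e * b <= r) -> b = 0.
  move=> b0 e0 H; apply/eqP; rewrite eq_le b0 andbT.
  by rewrite -(pmulr_rle0 _ e0); apply/ler_addgt0Pr => r r0; rewrite add0r H.
have etaE A : measurable A -> eta A = (fine (eta A))%:E.
  by move=> mA; rewrite fineK// fin_num_measure.
(* Every ray carries at least [e_ j] times the mass of [B3 j], whereas [ray_lower] provides rays of
   arbitrarily small mass. *)
have N3 j : eta.-negligible (B3 j).
  have mA : measurable (B3 j).
    apply: bigcapT_measurable => n; apply: measurable_set_bool; exact: measurable_fun_ler.
  exists (B3 j); split=> //; rewrite etaE//; congr EFin.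
  apply: (small _ (e_ j)) => // [|r r0]; first by rewrite fine_ge0.
  have [n pn] := ray_lower p r0.
  rewrite -lee_fin EFinM -etaE//; apply: le_trans (ltW pn).
  apply: (@le_trans _ _ (p (ray n `*` B3 j))); last first.
    apply: le_measure; rewrite ?inE; [exact: mray|exact: mray|].
    by move=> [x t] [].
  rewrite kE// -[leLHS]integral_cst//; apply: ge0_le_integral => //=.
  - by move=> t _; rewrite lee_fin ltW.
  - by apply/measurable_EFinP; exact: measurable_funTS.
  - by move=> t Bt; rewrite lee_fin; exact: Bt.
(* Over [B4 j] every ray captures at most the fraction [1 - e_ j] of the mass, whereas [ray_upper]
   provides rays capturing all of it up to [r]. *)
have N4 j : eta.-negligible (B4 j).
  have mA : measurable (B4 j).
    apply: bigcapT_measurable => n; apply: measurable_set_bool; exact: measurable_fun_ler.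
  exists (B4 j); split=> //; rewrite etaE//; congr EFin.
  apply: (small _ (e_ j)) => // [|r r0]; first by rewrite fine_ge0.
  have [n] := ray_upper p mA r0; rewrite pT// kE//.
  have : (\int[eta]_(t in B4 j) (k0 n t)%:E <= (1 - e_ j)%:E * eta (B4 j))%E.
    rewrite -[leRHS]integral_cst//; apply: ge0_le_integral => //=.
    - by move=> t _; rewrite lee_fin.
    - by apply/measurable_EFinP; exact: measurable_funTS.
    - by move=> t Bt; rewrite lee_fin; exact: Bt.
  move=> H1 /lt_le_trans; move/(_ _ (leeD2r r%:E H1)).
  rewrite etaE// -EFinM -EFinD lte_fin.
  by rewrite mulrBl mul1r -addrA ltrDl addrC subr_gt0 => /ltW.
pose bad := (\bigcup_m \bigcup_n B1 m n) `|` (\bigcup_n B2 n) `|`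
  (\bigcup_j B3 j) `|` (\bigcup_j B4 j).
have [N [mN N0 badN]] : eta.-negligible bad.
  do 3 (apply: negligibleU; last by apply: negligible_bigcup).
  by apply: negligible_bigcup => m; exact: negligible_bigcup.
(* The distribution function of the point mass at 0, a harmless choice on the null set. *)
pose h n : R := if 0 <= ratseq n then 1 else 0.
pose K n t := if t \in N then h n else k0 n t.
exists K; split=> [n|t|n A mA].
- apply: measurable_fun_ifT => //.
  by apply: (measurable_fun_bool true); rewrite setTI preimage_mem_true.
- have [tN|tN] := boolP (t \in N).
  + have -> : K ^~ t = h by apply/funext => n; rewrite /K tN.
    split=> [n|m n mn|e e0|e e0].
    * by rewrite /h; case: ifP => _; rewrite ?lexx ?ler01.
    * rewrite /h; case: (leP 0 (ratseq m)) => [m0|_].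
        by rewrite (le_trans m0 mn).
      by case: ifP.
    * have [|n /andP[_ n0]] := @ratseq_dense R (-1) 0; first by rewrite ltrN10.
      by exists n; rewrite /h leNgt n0.
    * have [|n /andP[n0 _]] := @ratseq_dense R 0 1; first exact: ltr01.
      by exists n; rewrite /h (ltW n0) gtrBl.
  + have -> : K ^~ t = k0 ^~ t by apply/funext => n; rewrite /K (negbTE tN).
    have Nt : ~ bad t by move=> /badN Nt; move/negP: tN; apply; rewrite inE.
    have ex_e e : 0 < e -> exists j, e_ j < e.
      move=> e0; exists (Num.truncn e^-1); rewrite -[ltRHS]invrK.
      by rewrite ltf_pV2 ?posrE ?invr_gt0// truncnS_gt.
    split=> [n|m n mn|e e0|e e0].
    * rewrite k_ge0/= leNgt; apply/negP => k1; apply: Nt; do 2 left; right.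
      by exists n.
    * rewrite leNgt; apply/negP => kmn; apply: Nt; do 3 left.
      by exists m => //; exists n => //; rewrite /B1 mn.
    * apply: contrapT => /forallNP nk; have [j je] := ex_e _ e0.
      apply: Nt; left; right; exists j => // n _ /=.
      by rewrite (le_trans (ltW je))// leNgt; apply/negP; exact: nk.
    * apply: contrapT => /forallNP nk; have [j je] := ex_e _ e0.
      apply: Nt; right; exists j => // n _ /=.
      rewrite leNgt; apply/negP => jk; apply: (nk n); apply: le_lt_trans jk.
      by rewrite lerD2l lerN2 ltW.
- rewrite kE//; apply: ge0_ae_eq_integral => //.
  + by apply/measurable_EFinP; exact: measurable_funTS.
  + apply/measurable_EFinP; apply: measurable_funTS; apply: measurable_fun_ifT => //.
    by apply: (measurable_fun_bool true); rewrite setTI preimage_mem_true.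
  + by move=> t _; rewrite lee_fin.
  + by move=> t _; rewrite lee_fin /K; case: ifP => // _; rewrite /h; case: ifP.
  + exists N; split=> // t /= Ht; apply: contrapT => Nt; apply: Ht => _.
    by rewrite /K memNset.
Qed.

End disintegration.

(** * Noise outsourcing *)

Section law.
Context d d' (W : measurableType d) (T : measurableType d') (R : realType).
Variables (P : probability W R) (f : W -> T) (mf : measurable_fun setT f).

Definition law : probability T R :=
  let X : {mfun W >-> T} := HB.pack f (isMeasurableFun.Build _ _ _ _ _ mf) in
  distribution P X.

Lemma lawE A : law A = P (f @^-1` A). Proof. by []. Qed.

Lemma ge0_integral_law (g : T -> \bar R) : measurable_fun setT g ->
  (forall t, 0 <= g t)%E -> (\int[law]_t g t = \int[P]_w g (f w))%E.
Proof. by move=> mg g0; rewrite ge0_integral_pushforward. Qed.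

End law.

(** * Measures determined by rays and by rectangles *)

Section measure_unique.
Context {R : realType}.

Lemma ray_setI (m n : nat) : exists k, ray m `&` ray n = ray k :> set R.
Proof.
have [mn|nm] := leP (ratseq m : R) (ratseq n).
  by exists m; apply: setIidl => x /= xm; exact: le_trans mn.
by exists n; apply: setIidr => x /= xn; apply: le_trans (ltW nm).
Qed.

Lemma measurable_rays : @measurable _ R = <<s [set ray n | n in setT] >>.
Proof.
apply/seteqP; split; last first.
  apply: smallest_sub; first exact: sigma_algebra_measurable.
  by move=> _ [n _ <-]; exact: measurable_ray.
rewrite [X in X `<=` _]RGenInftyO.measurableE.
apply: smallest_sub; first exact: smallest_sigma_algebra.
move=> _ [x ->].
rewrite (_ : `]-oo, x[%classic =
    \bigcup_n (if ratseq n < x then ray n else set0)); last first.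
  apply/seteqP; split=> y /=; rewrite in_itv/=.
    move=> /ratseq_dense[n /andP[yn nx]]; exists n => //; rewrite nx.
    exact: ltW.
  by move=> [n _]; case: ifP => // nx yn; exact: le_lt_trans nx.
apply: sigma_algebra_bigcup => n; case: ifP => _; last exact: sigma_algebra0.
by apply: sub_sigma_algebra; exists n.
Qed.

Lemma bigcup_ray : \bigcup_n ray n = [set: R].
Proof.
apply/seteqP; split=> // x _; have [|n /andP[xn _]] := @ratseq_dense R x (x + 1).
  by rewrite ltrDl.
by exists n => //; exact: ltW.
Qed.

Lemma measure_unique_ray (m1 m2 : {finite_measure set R -> \bar R}) :
  (forall n, m1 (ray n) = m2 (ray n)) -> forall A, measurable A -> m1 A = m2 A.
Proof.
move=> m12; apply: (measure_unique [set ray n | n in setT] (@ray R)).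
- exact: measurable_rays.
- move=> _ _ [m _ <-] [n _ <-]; have [k ->] := ray_setI m n; by exists k.
- by move=> i; exists i.
- exact: bigcup_ray.
- by move=> _ [n _ <-]; exact: m12.
- move=> k; rewrite -ge0_fin_numE ?measure_ge0// fin_num_measure//; exact: measurable_ray.
Qed.

Lemma measure_unique_rect d1 d2 (T1 : measurableType d1) (T2 : measurableType d2)
    (m1 m2 : {finite_measure set (T1 * T2)%type -> \bar R}) :
  (forall A B, measurable A -> measurable B -> m1 (A `*` B) = m2 (A `*` B)) ->
  forall D, measurable D -> m1 D = m2 D.
Proof.
move=> m12.
apply: (measure_unique [set A `*` B | A in measurable & B in measurable] (fun=> setT)).
- exact: measurable_prod_measurableType.
- move=> _ _ [A1 mA1 [B1 mB1 <-]] [A2 mA2 [B2 mB2 <-]].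
  exists (A1 `&` A2); first exact: measurableI.
  by exists (B1 `&` B2); [exact: measurableI|rewrite setXI].
- by move=> _; exists setT => //; exists setT => //; rewrite setXTT.
- by apply/seteqP; split=> // x _; exists 0%N.
- by move=> _ [A mA [B mB <-]]; exact: m12.
- by move=> _; rewrite -ge0_fin_numE ?measure_ge0// fin_num_measure.
Qed.

End measure_unique.

Section outsourcing.
Context d (T : measurableType d) (R : realType).
Variables (p : probability (R * T)%type R) (eta : probability T R).
Variable k : nat -> T -> R.
Hypothesis mk : forall n, measurable_fun setT (k n).
Hypothesis kc : forall t, cdf_like (k ^~ t).
Hypothesis kE : forall n A, measurable A ->
  p (ray n `*` A) = (\int[eta]_(t in A) (k n t)%:E)%E.

Let f (w : T * R) : R * T := (quantile (k ^~ w.1) w.2, w.1).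

Lemma measurable_outsourcing : measurable_fun setT f.
Proof.
apply: measurable_fun_pair => //.
by apply: (@measurable_quantile _ _ _ (fun n w => k n w.1)) => // n; exact: measurableT_comp.
Qed.

Let r := law (eta \x lam)%E measurable_outsourcing.

Let rE m A : measurable A ->
  r (ray m `*` A) = (\int[eta]_(t in A) lam [set u | (quantile (k ^~ t) u <= ratseq m)%R])%E.
Proof.
move=> mA; rewrite lawE /= /product_measure1 [RHS]integral_mkcond.
apply: eq_integral => t _; rewrite patchE /=; case: ifPn => tA.
  congr (lam _); apply/seteqP; split=> u; rewrite /xsection/= in_setE /f/=; first by case.
  by move=> ?; split=> //; rewrite -in_setE.
rewrite (_ : xsection _ _ = set0) ?measure0//.
by rewrite -subset0 => u; rewrite /xsection/= in_setE => -[_ /= At]; move/negP: tA; rewrite in_setE.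
Qed.

Let m_lam m : measurable_fun setT
  (fun t => lam [set u | (quantile (k ^~ t) u <= ratseq m)%R]).
Proof.
have mQ : measurable [set w : T * R | quantile (k ^~ w.1) w.2 <= ratseq m].
  apply: measurable_set_bool; apply: measurable_fun_ler => //.
  by apply: (@measurable_quantile _ _ _ (fun n w => k n w.1)) => // n; exact: measurableT_comp.
have := measurable_fun_xsection lam mQ.
apply: eq_measurable_fun => t _ /=; congr (lam _).
by apply/seteqP; split=> u; rewrite /xsection/= in_setE.
Qed.

(** The law of the quantile at [ratseq m] is at least [k m] and at most [k n] for any larger
    rational; right continuity of the mass of rays makes the two bounds meet. *)
Let r_ray m A : measurable A -> r (ray m `*` A) = p (ray m `*` A).
Proof.
move=> mA; apply/eqP; rewrite eq_le; apply/andP; split; last first.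
  rewrite rE// kE//; apply: ge0_le_integral => //.
  - by move=> t _; rewrite lee_fin; have [/(_ m)/andP[]] := kc t.
  - by apply/measurable_EFinP; exact: measurable_funTS.
  - exact: measurable_funTS.
  - by move=> t _; exact: (lam_quantile_ge m (kc t)).
apply/lee_addgt0Pr => e e0; have [n mn /ltW] := ray_right p m mA e0.
apply: le_trans; rewrite rE// kE//; apply: ge0_le_integral => //.
- exact: measurable_funTS.
- by apply/measurable_EFinP; exact: measurable_funTS.
- by move=> t _; exact: (lam_quantile_le (kc t)).
Qed.

(** Inverse transform sampling in each fibre. Agreement on rectangles suffices, and for a fixed side
    [A] agreement on rays suffices; the swap puts the fixed side first, as [slice_measure]
    expects. *)
Theorem outsourcing (D : set (R * T)) : measurable D -> r D = p D.
Proof.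
apply: measure_unique_rect => B A mB mA.
have swapE (q : probability (R * T)%type R) B' :
    slice_measure (law q (@measurable_swap _ _ _ _)) mA B' = q (B' `*` A).
  rewrite /slice_measure lawE; congr (q _).
  by apply/seteqP; split=> -[x t] [].
transitivity (slice_measure (law r (@measurable_swap _ _ _ _)) mA B); first by rewrite swapE.
transitivity (slice_measure (law p (@measurable_swap _ _ _ _)) mA B); last by rewrite swapE.
apply: measure_unique_ray => // n.
exact: etrans (swapE r (ray n)) (etrans (r_ray n mA) (esym (swapE p (ray n)))).
Qed.

End outsourcing.

(** * A universal parametrisation of the laws on the plane *)

Notation bitstream := (g_sigma_algebraType bit_cylinders).

Section universal.
Context {R : realType}.

Lemma measurable_bit n : measurable_fun setT (fun x : bitstream => x n : bool).
Proof.
apply: (measurable_fun_bool true); rewrite setTI; apply: sub_sigma_algebra.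
by exists n.
Qed.

(** The stream is a double array via [pickle]; row [n] is the Dedekind cut of the value of a
    distribution function at the rational [ratseq n]. *)
Definition code_val (n : nat) (x : bitstream) : R :=
  cut_value (fun m => (x : nat -> bool) (@pickle (nat * nat)%type (n, m))).

Lemma measurable_code_val n : measurable_fun setT (code_val n).
Proof. by apply: measurable_cut_value => m; exact: measurable_bit. Qed.

Definition universal (w : bitstream * R) : R * R :=
  pair_decode (quantile (code_val ^~ w.1) w.2).

Lemma measurable_universal : measurable_fun setT universal.
Proof.
apply: (measurableT_comp measurable_pair_decode).
apply: (@measurable_quantile _ _ _ (fun n w => code_val n w.1)) => // n.
by apply: (measurableT_comp (measurable_code_val n)).
Qed.

Lemma measurable_universal1 x : measurable_fun setT (fun u : R => universal (x, u)).
Proof. exact: (measurableT_comp measurable_universal (pair1_measurable x)). Qed.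

Lemma measurable_pair_tt : measurable_fun setT (fun z : R => (z, tt)).
Proof. exact: measurable_fun_pair. Qed.

(* Every law is read off its distribution function at the rationals, obtained here by
   disintegrating over a one-point space. *)
Theorem universal_law (q : probability (R * R)%type R) :
  exists x, forall A, measurable A -> law lam (measurable_universal1 x) A = q A.
Proof.
pose p0 := law q measurable_pair_code.
pose p := law p0 measurable_pair_tt.
pose eta := law p (@measurable_snd _ _ _ _).
have [|k [mk kc kE]] := @disintegration _ _ _ p eta.
  move=> A mA; change (p (setT `*` A) = p (snd @^-1` A)); congr (p _).
  by apply/seteqP; split=> [[z t] []|[z t]].
have pE := outsourcing mk kc kE.
pose x i := if @unpickle (nat * nat)%type i is Some (n, m) then ratseq m < k n tt else false.
have xE : code_val ^~ x = k ^~ tt.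
  apply/funext => n; rewrite /code_val /x.
  by under [X in cut_value X]eq_fun do rewrite pickleK; exact: cut_valueK.
have mQ : measurable_fun setT (quantile (k ^~ tt)).
  by apply: (@measurable_quantile _ _ _ (fun n _ => k n tt)).
exists x => A mA; rewrite lawE.
have mQA : measurable (quantile (k ^~ tt) @^-1` (pair_decode @^-1` A)).
  rewrite -[X in measurable X]setTI -comp_preimage.
  by apply: (measurableT_comp measurable_pair_decode).
have mpA : measurable (pair_decode @^-1` A : set R).
  by rewrite -[X in measurable X]setTI; exact: measurable_pair_decode.
rewrite (_ : _ @^-1` A = quantile (k ^~ tt) @^-1` (pair_decode @^-1` A)); last first.
  by apply/seteqP; split=> u; rewrite /preimage/= /universal/= xE.
have <- : p ((pair_decode @^-1` A) `*` setT) = q A.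
  change (q (pair_code @^-1` ((fun z => (z, tt)) @^-1` ((pair_decode @^-1` A) `*` setT))) = q A).
  congr (q _); apply/seteqP; split=> [z []|z Az] /=; first by rewrite pair_codeK.
  by split; rewrite //= pair_codeK.
rewrite -pE; last exact: measurableX.
rewrite lawE (_ : _ @^-1` _ = setT `*` (quantile (k ^~ tt) @^-1` (pair_decode @^-1` A))).
  by rewrite /= product_measure1E// [X in (X * _)%E]probability_setT mul1e.
by apply/seteqP; split=> -[[] u] /= [].
Qed.

End universal.

(** * The fused Gromov-Wasserstein cost and gluing *)

Section cost.
Context {R : realType} (beta : R) (d1 : R -> R -> R).
Hypothesis md1 : measurable_fun setT (fun st : R * R => d1 st.1 st.2).
Hypothesis d1_ge0 : forall x y, 0 <= d1 x y.
Hypothesis beta01 : 0 <= beta <= 1.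

Lemma measurable_d1 d (W : measurableType d) (f g : W -> R) :
  measurable_fun setT f -> measurable_fun setT g ->
  measurable_fun setT (fun w => (d1 (f w) (g w))%:E).
Proof.
move=> mf mg; apply/measurable_EFinP.
exact: (measurableT_comp md1 (measurable_fun_pair mf mg)).
Qed.

Lemma measurable_sqr_d1 d (W : measurableType d) (f f' g g' : W -> R) :
  measurable_fun setT f -> measurable_fun setT f' ->
  measurable_fun setT g -> measurable_fun setT g' ->
  measurable_fun setT (fun w => ((d1 (f w) (f' w) - d1 (g w) (g' w)) ^+ 2)%:E).
Proof.
move=> mf mf' mg mg'; apply/measurable_EFinP; apply: measurable_funX.
by apply: measurable_funB; apply/measurable_EFinP; exact: measurable_d1.
Qed.

(** The cost of a coupling realised by random variables, so that three marginals can be compared on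
    one probability space. *)
Definition rv_cost d (W : measurableType d) (P : probability W R) (X Y : W -> R) : \bar R :=
  ((1 - beta)%:E * \int[P]_w (d1 (X w) (Y w))%:E
   + beta%:E * \int[P]_w \int[P]_w' ((d1 (X w) (X w') - d1 (Y w) (Y w')) ^+ 2)%:E)%E.

Section rv_cost.
Context d (W : measurableType d) (P : probability W R).
Implicit Types X Y Z : W -> R.

Let I X Y := (\int[P]_w (d1 (X w) (Y w))%:E)%E.
Let J X Y := (\int[P]_w \int[P]_w' ((d1 (X w) (X w') - d1 (Y w) (Y w')) ^+ 2)%:E)%E.

Let I_ge0 X Y : (0 <= I X Y)%E.
Proof. by apply: integral_ge0 => w _; rewrite lee_fin. Qed.

Let J_ge0 X Y : (0 <= J X Y)%E.
Proof.
by apply: integral_ge0 => w _; apply: integral_ge0 => w' _; rewrite lee_fin sqr_ge0.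
Qed.

Let b1_ge0 : (0 <= (1 - beta)%:E)%E.
Proof. by case/andP: beta01 => _ b1; rewrite lee_fin subr_ge0. Qed.

Let b_ge0 : (0 <= beta%:E)%E.
Proof. by case/andP: beta01; rewrite lee_fin. Qed.

Lemma rv_cost_ge0 X Y : (0 <= rv_cost P X Y)%E.
Proof. by rewrite /rv_cost adde_ge0// mule_ge0//; [exact: I_ge0|exact: J_ge0]. Qed.

Let m_sqr X Y : measurable_fun setT X -> measurable_fun setT Y ->
  measurable_fun setT (fun ww : W * W =>
    ((d1 (X ww.1) (X ww.2) - d1 (Y ww.1) (Y ww.2)) ^+ 2)%:E).
Proof. by move=> mX mY; apply: measurable_sqr_d1; exact: measurableT_comp. Qed.

Let sqr_w X Y : measurable_fun setT X -> measurable_fun setT Y -> forall w,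
  measurable_fun setT (fun w' => ((d1 (X w) (X w') - d1 (Y w) (Y w')) ^+ 2)%:E).
Proof. by move=> mX mY w; exact: measurable_sqr_d1. Qed.

Let m_int X Y : measurable_fun setT X -> measurable_fun setT Y ->
  measurable_fun setT (fun w =>
    (\int[P]_w' ((d1 (X w) (X w') - d1 (Y w) (Y w')) ^+ 2)%:E)%E).
Proof.
move=> mX mY; apply: (measurable_fun_fubini_tonelli_F (m2 := P) _ (m_sqr mX mY)).
by move=> w; rewrite lee_fin sqr_ge0.
Qed.

(** The linear term inherits the constant [C] from [d1], and the quadratic term has constant 2 by
    convexity of the square; [C + 2] dominates both. *)
Lemma rv_cost_triangle X Y Z (C : R) :
  measurable_fun setT X -> measurable_fun setT Y -> measurable_fun setT Z ->
  0 < C -> (forall x y z, d1 x z <= C * (d1 x y + d1 y z)) ->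
  (rv_cost P X Z <= (C + 2)%:E * (rv_cost P X Y + rv_cost P Y Z))%E.
Proof.
move=> mX mY mZ C0 tri.
have C2 : 0 <= C + 2 by rewrite addr_ge0// ltW.
have leI : (I X Z <= (C + 2)%:E * (I X Y + I Y Z))%E.
  rewrite -ge0_integralD//; first last.
  - exact: measurable_d1.
  - by move=> w _; rewrite lee_fin.
  - exact: measurable_d1.
  - by move=> w _; rewrite lee_fin.
  rewrite -ge0_integralZl//; first last.
  - by move=> w _; rewrite adde_ge0// lee_fin.
  - by apply: emeasurable_funD; exact: measurable_d1.
  apply: ge0_le_integral => //.
  - by move=> w _; rewrite lee_fin.
  - exact: measurable_d1.
  - by apply: measurable_funeM; apply: emeasurable_funD; exact: measurable_d1.
  - move=> w _; rewrite -EFinD -EFinM lee_fin (le_trans (tri _ (Y w) _))//.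
    by rewrite ler_wpM2r ?addr_ge0// lerDl.
have leJ : (J X Z <= (C + 2)%:E * (J X Y + J Y Z))%E.
  rewrite -ge0_integralD//; first last.
  - exact: m_int.
  - by move=> w _; apply: integral_ge0 => w' _; rewrite lee_fin sqr_ge0.
  - exact: m_int.
  - by move=> w _; apply: integral_ge0 => w' _; rewrite lee_fin sqr_ge0.
  rewrite -ge0_integralZl//; first last.
  - by move=> w _; rewrite adde_ge0//; apply: integral_ge0 => w' _; rewrite lee_fin sqr_ge0.
  - by apply: emeasurable_funD; exact: m_int.
  apply: ge0_le_integral => //.
  - by move=> w _; apply: integral_ge0 => w' _; rewrite lee_fin sqr_ge0.
  - exact: m_int.
  - by apply: measurable_funeM; apply: emeasurable_funD; exact: m_int.
  move=> w _; rewrite -ge0_integralD//; first last.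
  - exact: sqr_w.
  - by move=> w' _; rewrite lee_fin sqr_ge0.
  - exact: sqr_w.
  - by move=> w' _; rewrite lee_fin sqr_ge0.
  rewrite -ge0_integralZl//; first last.
  - by move=> w' _; rewrite adde_ge0// lee_fin sqr_ge0.
  - by apply: emeasurable_funD; exact: sqr_w.
  apply: ge0_le_integral => //.
  - by move=> w' _; rewrite lee_fin sqr_ge0.
  - exact: sqr_w.
  - by apply: measurable_funeM; apply: emeasurable_funD; exact: sqr_w.
  move=> w' _; rewrite -EFinD -EFinM lee_fin.
  move: (d1 (X w) _) (d1 (Y w) _) (d1 (Z w) _) => a b c.
  have h : (a - c) ^+ 2 <= 2 * ((a - b) ^+ 2 + (b - c) ^+ 2).
    by rewrite -subr_ge0 (_ : _ - _ = (a - b - (b - c)) ^+ 2) ?sqr_ge0//; ring.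
  by rewrite (le_trans h)// ler_wpM2r ?addr_ge0 ?sqr_ge0// lerDr ltW.
have cC2 : (0 <= (C + 2)%:E)%E by rewrite lee_fin.
rewrite /rv_cost -/(I X Z) -/(J X Z) -/(I X Y) -/(J X Y) -/(I Y Z) -/(J Y Z).
move: leI leJ (I_ge0 X Y) (I_ge0 Y Z) (J_ge0 X Y) (J_ge0 Y Z).
move: (I X Z) (I X Y) (I Y Z) (J X Z) (J X Y) (J Y Z) => i i1 i2 j j1 j2 lei lej *.
apply: (@le_trans _ _ ((1 - beta)%:E * ((C + 2)%:E * (i1 + i2)) +
    beta%:E * ((C + 2)%:E * (j1 + j2)))%E).
  by apply: leeD; apply: lee_wpmul2l.
rewrite (muleCA (1 - beta)%:E) (muleCA beta%:E) -ge0_muleDr ?mule_ge0 ?adde_ge0//.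
by rewrite (ge0_muleDr (1 - beta)%:E)// (ge0_muleDr beta%:E)// addeACA.
Qed.

Lemma rv_costC X Y : (forall x y, d1 x y = d1 y x) -> rv_cost P X Y = rv_cost P Y X.
Proof.
move=> d1C; rewrite /rv_cost; congr (_ * _ + _ * _)%E.
  by apply: eq_integral => w _; rewrite d1C.
by apply: eq_integral => w _; apply: eq_integral => w' _; rewrite -sqrrN opprB.
Qed.

End rv_cost.

Lemma fgw_cost_law d (W : measurableType d) (P : probability W R)
    (X : W -> R * R) (mX : measurable_fun setT X) (p : probability (R * R)%type R) :
  (forall A, measurable A -> p A = law P mX A) ->
  fgw_cost beta d1 p = rv_cost P (fun w => (X w).1) (fun w => (X w).2).
Proof.
move=> pE.
have intE f : measurable_fun setT f -> (forall t, 0 <= f t)%E ->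
    (\int[p]_t f t = \int[P]_w f (X w))%E.
  move=> mf f0; rewrite -(ge0_integral_law P mX)//.
  by apply: eq_measure_integral => A mA _; exact: pE.
rewrite /fgw_cost /rv_cost; congr (_ * _ + _ * _)%E.
  by rewrite intE// => [|t]; [exact: measurable_d1|rewrite lee_fin].
under eq_integral => st _.
  rewrite intE; [|exact: measurable_sqr_d1|by move=> t; rewrite lee_fin sqr_ge0].
  over.
rewrite intE//; last first.
  by move=> t; apply: integral_ge0 => w _; rewrite lee_fin sqr_ge0.
apply: (measurable_fun_fubini_tonelli_F (m2 := P) (fun z : (R * R) * W =>
  ((d1 z.1.1 (X z.2).1 - d1 z.1.2 (X z.2).2) ^+ 2)%:E)).
  by apply: measurable_sqr_d1 => //; do ?apply: measurableT_comp => //.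
by move=> z; rewrite lee_fin sqr_ge0.
Qed.

End cost.

Lemma product_probability_fst {R : realType} d1 d2 (T1 : measurableType d1)
    (T2 : measurableType d2) (P1 : probability T1 R) (P2 : probability T2 R)
    (A : set T1) : measurable A -> (P1 \x P2)%E (A `*` setT) = P1 A.
Proof. by move=> mA; rewrite product_measure1E// [X in (_ * X)%E]probability_setT mule1. Qed.

Section gluing.
Context {R : realType}.

(** [X] and [Z] are made conditionally independent given [Y]: two independent uniform variables
    drive their conditional quantiles. Swapping [q] places the common marginal second, where
    [disintegration] conditions. *)
Theorem gluing (p q : probability (R * R)%type R) :
  (forall A, measurable A -> p (setT `*` A) = q (A `*` setT)) ->
  exists d (W : measurableType d) (P : probability W R) (X Y Z : W -> R)
    (mXY : measurable_fun setT (fun w => (X w, Y w)))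
    (mYZ : measurable_fun setT (fun w => (Y w, Z w))),
    (forall D, measurable D -> p D = law P mXY D) /\
    (forall D, measurable D -> q D = law P mYZ D).
Proof.
move=> pq.
pose eta := law p (@measurable_snd _ _ _ _).
have peta A : measurable A -> p (setT `*` A) = eta A.
  move=> mA; change (p (setT `*` A) = p (snd @^-1` A)); congr (p _).
  by apply/seteqP; split=> [[z t] []|[z t]].
pose q' := law q (@measurable_swap _ _ _ _).
have q'E D : q' D = q (swap @^-1` D) by [].
have qeta A : measurable A -> q' (setT `*` A) = eta A.
  move=> mA; rewrite -peta// pq// q'E; congr (q _).
  by apply/seteqP; split=> -[x y] [].
have [k [mk kc kE]] := disintegration peta.
have [l [ml lc lE]] := disintegration qeta.
have pE := outsourcing mk kc kE; have qE := outsourcing ml lc lE.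
pose W : measurableType _ := (R * measurableTypeR R * measurableTypeR R)%type.
pose P : probability W R := ((eta \x lam) \x lam)%E.
pose X (w : W) := quantile (k ^~ w.1.1) w.1.2.
pose Y (w : W) := w.1.1.
pose Z (w : W) := quantile (l ^~ w.1.1) w.2.
have mY : measurable_fun setT Y by exact: measurableT_comp.
have m12 : measurable_fun setT (fun w : W => w.1.2) by exact: measurableT_comp.
have mX : measurable_fun setT X.
  apply: (@measurable_quantile _ _ _ (fun n w => k n w.1.1)) => // n.
  exact: (measurableT_comp (mk n)).
have mZ : measurable_fun setT Z.
  apply: (@measurable_quantile _ _ _ (fun n w => l n w.1.1)) => // n.
  exact: (measurableT_comp (ml n)).
exists _, W, P, X, Y, Z, (measurable_fun_pair mX mY), (measurable_fun_pair mY mZ).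
have mpre d (V : measurableType d) (f : V -> R * R) (mf : measurable_fun setT f) D :
    measurable D -> measurable (f @^-1` D).
  by move=> mD; rewrite -[X in measurable X]setTI; exact: mf.
split=> D mD.
  rewrite -pE// !lawE.
  have mB := mpre _ _ _ (measurable_outsourcing mk) D mD.
  transitivity (P ((fun w => (quantile (k ^~ w.1) w.2, w.1)) @^-1` D `*` setT)); last first.
    by congr (P _); apply/seteqP; split=> -[w v] //= [].
  exact/esym/product_probability_fst.
(* [Z] uses only [Y] and the second uniform variable; forgetting the first one leaves the product of
   [eta] and [lam]. *)
pose F (w : W) : (R * measurableTypeR R)%type := (w.1.1, w.2).
have mF : measurable_fun setT F by exact: measurable_fun_pair.
have PF D' : measurable D' -> law P mF D' = (eta \x lam)%E D'.
  pose P2 : probability _ R := (eta \x lam)%E.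
  have h := @measure_unique_rect R _ _ _ _ (law P mF) P2.
  apply: (h) => // A B mA mB.
  change (P (F @^-1` (A `*` B)) = (eta \x lam)%E (A `*` B)).
  rewrite (_ : _ @^-1` _ = (A `*` setT) `*` B); last first.
    by apply/seteqP; split=> -[[a b] c] /= [] // [].
  have mAT : measurable (A `*` setT : set (R * measurableTypeR R)) by exact: measurableX.
  rewrite [LHS](product_measure1E _ _ mAT mB) [RHS](product_measure1E _ _ mA mB).
  by congr (_ * _)%E; exact: product_probability_fst.
have mB := mpre _ _ _ (measurable_outsourcing ml) (swap @^-1` D).
have msD : measurable (swap @^-1` D : set (R * R)).
  by apply: mpre => //; exact: measurable_swap.
transitivity (q' (swap @^-1` D)).
  by rewrite q'E; congr (q _); apply/seteqP; split=> -[].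
rewrite -qE// -[LHS]/((eta \x lam)%E (_ @^-1` _)) -PF; last exact: mB.
by [].
Qed.

End gluing.

Lemma le_add_ereal_inf {R : realType} (A B : set \bar R) (x : \bar R) :
  (forall a, A a -> 0 <= a)%E -> (forall b, B b -> 0 <= b)%E ->
  (forall a b, A a -> B b -> x <= a + b)%E ->
  (x <= ereal_inf A + ereal_inf B)%E.
Proof.
move=> A0 B0 xAB.
have iA0 : (0 <= ereal_inf A)%E by apply/ereal_infP.
have iB0 : (0 <= ereal_inf B)%E by apply/ereal_infP.
have [Afin|] := boolP (ereal_inf A \is a fin_num); last first.
  rewrite ge0_fin_numE// -leNgt leye_eq => /eqP ->.
  by rewrite addye ?leey// gt_eqF// (lt_le_trans _ iB0).
have [Bfin|] := boolP (ereal_inf B \is a fin_num); last first.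
  rewrite ge0_fin_numE// -leNgt leye_eq => /eqP ->.
  by rewrite addey ?leey// gt_eqF// (lt_le_trans _ iA0).
apply/lee_addgt0Pr => e e0.
have e20 : 0 < e / 2 by rewrite divr_gt0.
have [a Aa ae] := lb_ereal_inf_adherent e20 Afin.
have [b Bb be] := lb_ereal_inf_adherent e20 Bfin.
apply: (le_trans (xAB _ _ Aa Bb)); apply: (le_trans (leeD (ltW ae) (ltW be))).
by rewrite addeACA -EFinD -splitr.
Qed.

(** * Pointwise properties of [D_fgw] *)

Section D_fgw.
Context {R : realType} (beta : R) (d1 : R -> R -> R).
Hypothesis md1 : measurable_fun setT (fun st : R * R => d1 st.1 st.2).
Hypothesis d1_ge0 : forall x y, 0 <= d1 x y.
Hypothesis beta01 : 0 <= beta <= 1.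
Local Notation D rho eta := (D_fgw rho eta beta d1).

Lemma fgw_costE (p : probability (R * R)%type R) :
  fgw_cost beta d1 p = rv_cost beta d1 p fst snd.
Proof. by []. Qed.

Lemma D_fgw_ge0 (rho eta : set R -> \bar R) : (0 <= D rho eta)%E.
Proof.
by apply/ereal_infP => _ [p _ <-]; rewrite fgw_costE; exact: rv_cost_ge0.
Qed.

Lemma D_fgwC (rho eta : set R -> \bar R) : (forall x y, d1 x y = d1 y x) ->
  D rho eta = D eta rho.
Proof.
move=> d1C.
suff H (r1 r2 : set R -> \bar R) : (D r1 r2 <= D r2 r1)%E.
  by apply/eqP; rewrite eq_le !H.
apply/ereal_infP => _ [p pc <-]; apply: ereal_inf_lbound.
exists (law p (@measurable_swap _ _ _ _)).
  move=> A mA; have [h1 h2] := pc _ mA; split.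
    change (p (swap @^-1` (A `*` setT)) = r1 A).
    by rewrite -h2; congr (p _); apply/seteqP; split=> -[x y] [].
  change (p (swap @^-1` (setT `*` A)) = r2 A).
  by rewrite -h1; congr (p _); apply/seteqP; split=> -[x y] [].
have lawp A : measurable A -> law p (@measurable_swap _ _ _ _) A =
    law p (@measurable_swap _ _ _ _) A by [].
by rewrite (fgw_cost_law beta md1 d1_ge0 lawp) fgw_costE rv_costC.
Qed.

(** After gluing, the law of [(X, Z)] competes in the infimum for [rho] and [xi]. Dividing by
    [C + 2] first leaves a bound valid for all pairs of couplings, hence for the sum of the
    infima. *)
Lemma D_fgw_triangle (C : R) (rho eta xi : set R -> \bar R) :
  0 < C -> (forall x y z, d1 x z <= C * (d1 x y + d1 y z)) ->
  (D rho xi <= (C + 2)%:E * (D rho eta + D eta xi))%E.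
Proof.
move=> C0 tri.
have C2 : 0 < C + 2 by rewrite addr_gt0.
rewrite -lee_pdivrMl//; apply: le_add_ereal_inf.
- by move=> _ [p _ <-]; rewrite fgw_costE; exact: rv_cost_ge0.
- by move=> _ [p _ <-]; rewrite fgw_costE; exact: rv_cost_ge0.
move=> _ _ [p pc <-] [q qc <-]; rewrite lee_pdivrMl//.
have [|d [W [P [X [Y [Z [mXY [mYZ [pE qE]]]]]]]]] := @gluing _ p q.
  by move=> A mA; have [_ ->] := pc _ mA; have [-> _] := qc _ mA.
have [mX mY] : measurable_fun setT X /\ measurable_fun setT Y.
  by have /measurable_fun_pairP[] := mXY.
have mZ : measurable_fun setT Z by have /measurable_fun_pairP[] := mYZ.
have mXZ := measurable_fun_pair mX mZ.
rewrite (fgw_cost_law beta md1 d1_ge0 pE) (fgw_cost_law beta md1 d1_ge0 qE) /=.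
apply: le_trans (rv_cost_triangle md1 d1_ge0 beta01 P mX mY mZ C0 tri).
apply: ereal_inf_lbound; exists (law P mXZ); last first.
  have lawP A : measurable A -> law P mXZ A = law P mXZ A by [].
  by rewrite (fgw_cost_law beta md1 d1_ge0 lawP).
move=> A mA; have [h1 _] := pc _ mA; have [_ h2] := qc _ mA.
have mAT : measurable (A `*` [set: R]) by exact: measurableX.
have mTA : measurable ([set: R] `*` A) by exact: measurableX.
rewrite -h1 -h2 pE// qE// !lawE; split; congr (P _).
Qed.

End D_fgw.

(** * Measurability of D_fgw *)

Section D_fgw_souslin.
Context {R : realType} (beta : R) (d1 : R -> R -> R).
Hypothesis md1 : measurable_fun setT (fun st : R * R => d1 st.1 st.2).
Hypothesis d1_ge0 : forall x y, 0 <= d1 x y.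
Local Notation univ := (@universal R).

Definition universal_cost (x : bitstream) : \bar R :=
  rv_cost beta d1 lam (fun u => (univ (x, u)).1) (fun u => (univ (x, u)).2).

Lemma measurable_universal_cost : measurable_fun setT universal_cost.
Proof.
have mu1 : measurable_fun setT (fun w => (univ w).1).
  exact: (measurableT_comp measurable_fst measurable_universal).
have mu2 : measurable_fun setT (fun w => (univ w).2).
  exact: (measurableT_comp measurable_snd measurable_universal).
apply: emeasurable_funD; apply: measurable_funeM.
  apply: (measurable_fun_fubini_tonelli_F (m2 := lam)
    (fun w : bitstream * measurableTypeR R => (d1 (univ w).1 (univ w).2)%:E)).
    exact: measurable_d1.
  by move=> w; rewrite lee_fin.
pose g (z : bitstream * measurableTypeR R * measurableTypeR R) :=
  ((d1 (univ z.1).1 (univ (z.1.1, z.2)).1 - d1 (univ z.1).2 (univ (z.1.1, z.2)).2) ^+ 2)%:E.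
have m13 : measurable_fun setT
    (fun z : bitstream * measurableTypeR R * measurableTypeR R => (z.1.1, z.2)).
  by apply: measurable_fun_pair => //; exact: measurableT_comp.
have mg : measurable_fun setT g.
  apply: measurable_sqr_d1 => //.
  - exact: (measurableT_comp mu1).
  - exact: (measurableT_comp mu1).
  - exact: (measurableT_comp mu2).
  - exact: (measurableT_comp mu2).
have g0 z : (0 <= g z)%E by rewrite lee_fin sqr_ge0.
apply: (measurable_fun_fubini_tonelli_F (m2 := lam)
  (fun w : bitstream * measurableTypeR R => (\int[lam]_u g (w, u))%E)).
  exact: (measurable_fun_fubini_tonelli_F (m2 := lam) g mg g0).
by move=> w; apply: integral_ge0.
Qed.

Lemma fgw_cost_universal x (p : probability (R * R)%type R) :
  (forall A, measurable A -> law lam (measurable_universal1 x) A = p A) ->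
  fgw_cost beta d1 p = universal_cost x.
Proof.
move=> pE; have pE' A : measurable A -> p A = law lam (measurable_universal1 x) A.
  by move=> mA; rewrite pE.
by rewrite (fgw_cost_law beta md1 d1_ge0 pE').
Qed.

Lemma measurable_universal_law (D : set (R * R)) : measurable D ->
  measurable_fun setT (fun x => law lam (measurable_universal1 x) D).
Proof.
move=> mD.
have mU : measurable (univ @^-1` D).
  by rewrite -[X in measurable X]setTI; exact: measurable_universal.
have := measurable_fun_xsection lam mU.
apply: eq_measurable_fun => x _ /=; congr (lam _).
by apply/seteqP; split=> u; rewrite /xsection/= in_setE.
Qed.

(** Being a coupling becomes countably many equations, hence a measurable condition on a code of the
    law. *)
Lemma coupling_ray (rho eta : probability R R) (p : probability (R * R)%type R) :
  coupling rho eta p <-> forall n, p (ray n `*` setT) = rho (ray n) /\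
    p (setT `*` ray n) = eta (ray n).
Proof.
split=> [pc n|H]; first by apply: pc; exact: measurable_ray.
have fstE A : law p (@measurable_fst _ _ _ _) A = p (A `*` setT).
  change (p (fst @^-1` A) = p (A `*` setT)); congr (p _).
  by apply/seteqP; split=> [[z t]|[z t] []].
have sndE A : law p (@measurable_snd _ _ _ _) A = p (setT `*` A).
  change (p (snd @^-1` A) = p (setT `*` A)); congr (p _).
  by apply/seteqP; split=> [[z t]|[z t] []].
move=> A mA; rewrite -fstE -sndE; split; apply: measure_unique_ray => // n.
  exact: etrans (fstE _) (H n).1.
exact: etrans (sndE _) (H n).2.
Qed.

Theorem D_fgw_souslin d (T : measurableType d) (rho eta : T -> probability R R) :
  (forall n, measurable_fun setT (fun t => rho t (ray n))) ->
  (forall n, measurable_fun setT (fun t => eta t (ray n))) ->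
  forall a, souslin [set t | (D_fgw (rho t) (eta t) beta d1 < a)%E].
Proof.
move=> mrho meta a.
pose U x := law lam (measurable_universal1 x) : probability (R * R)%type R.
(* Pairs of a parameter and a code of one of its couplings of cost below [a]. Strictness of the
   inequality makes the infimum lie below [a] exactly when some coupling does. *)
pose E : set (T * bitstream) := [set w | (universal_cost w.2 < a)%E] `&`
  \bigcap_n ([set w | U w.2 (ray n `*` setT) = rho w.1 (ray n)] `&`
             [set w | U w.2 (setT `*` ray n) = eta w.1 (ray n)]).
have meq (f g : T * bitstream -> \bar R) : measurable_fun setT f ->
    measurable_fun setT g -> measurable [set w | f w = g w].
  move=> mf mg; rewrite (_ : [set _ | _] =
      [set w | (f w <= g w)%E] `&` [set w | (g w <= f w)%E]); last first.
    apply/seteqP; split=> w /=; first by move=> ->.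
    by move=> [fg gf]; apply/eqP; rewrite eq_le fg.
  by apply: measurableI; apply: measurable_set_bool; exact: measurable_fun_lee.
have mE : measurable E.
  apply: measurableI.
    apply: measurable_set_bool; apply: measurable_fun_lte => //.
    exact: (measurableT_comp measurable_universal_cost).
  apply: bigcapT_measurable => n; apply: measurableI; apply: meq.
  - apply: (measurableT_comp (@measurable_universal_law (ray n `*` setT) _)) => //.
    by apply: measurableX => //; exact: measurable_ray.
  - exact: (measurableT_comp (mrho n)).
  - apply: (measurableT_comp (@measurable_universal_law (setT `*` ray n) _)) => //.
    by apply: measurableX => //; exact: measurable_ray.
  - exact: (measurableT_comp (meta n)).
have := souslin_projection mE; congr souslin; apply/seteqP; split=> [t [x [/= xa Ex]]|t /=].
  apply/ereal_inf_ltP; exists (universal_cost x) => //; exists (U x); last exact: fgw_cost_universal.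
  by apply/coupling_ray => n; exact: (Ex n I).
move=> /ereal_inf_ltP[_ [p pc <-]].
have [x xE] := universal_law p; rewrite (fgw_cost_universal xE) => xa.
exists x; split=> // n _.
have [h1 h2] := (coupling_ray (rho t) (eta t) p).1 pc n.
by split; [apply: etrans (xE _ _) h1|apply: etrans (xE _ _) h2];
  apply: measurableX => //; exact: measurable_ray.
Qed.

End D_fgw_souslin.

(** * Iterated integrals *)

(** The integral of a non-negative function is a supremum over the simple functions below it, which
    is monotone without measurability. *)
Lemma ge0_le_integral_nonmeasurable d (T : measurableType d) (R : realType)
    (mu : {measure set T -> \bar R}) (f g : T -> \bar R) :
  (forall x, 0 <= f x)%E -> (forall x, f x <= g x)%E ->
  (\int[mu]_x f x <= \int[mu]_x g x)%E.
Proof.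
move=> f0 fg; rewrite !ge0_integralTE//; last by move=> x; exact: le_trans (fg x).
by apply: ereal_sup_le => _ [h hf <-]; exists h => // x; exact: le_trans (fg x).
Qed.

Section iint.
Context {R : realType}.
Local Notation leb := (@lebesgue_measure R).

Lemma iintS n (f : n.+1.-tuple R -> \bar R) :
  iint f = (\int[leb]_y iint (fun s : n.-tuple R => f (@cons_tuple n R y s)))%E.
Proof. by []. Qed.

Lemma iint_ge0 n (f : n.-tuple R -> \bar R) : (forall x, 0 <= f x)%E -> (0 <= iint f)%E.
Proof. by elim: n f => [|n IH] f f0; [exact: f0|]; rewrite iintS; apply: integral_ge0 => y _; exact: IH. Qed.

Lemma le_iint n (f g : n.-tuple R -> \bar R) : (forall x, 0 <= f x)%E ->
  (forall x, f x <= g x)%E -> (iint f <= iint g)%E.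
Proof.
elim: n f g => [|n IH] f g f0 fg; first exact: fg.
rewrite !iintS; apply: ge0_le_integral_nonmeasurable => y; first exact: iint_ge0.
by apply: IH.
Qed.

Lemma measurable_cons_tuple n :
  measurable_fun setT (fun z : measurableTypeR R * n.-tuple R => @cons_tuple n R z.1 z.2).
Proof.
apply: (@measurable_cons _ _ _ _ (fun z : measurableTypeR R * n.-tuple R => z.1 : R)).
- exact: measurable_fst.
- exact: measurable_snd.
Qed.

Lemma measurable_iint d (T : measurableType d) n (f : T * n.-tuple R -> \bar R) :
  measurable_fun setT f -> (forall z, 0 <= f z)%E ->
  measurable_fun setT (fun t => iint (fun s => f (t, s))).
Proof.
elim: n d T f => [|n IH] d T f mf f0.
  exact: (measurableT_comp mf (pair2_measurable _)).
pose g (z : T * measurableTypeR R * n.-tuple R) := f (z.1.1, @cons_tuple n R z.1.2 z.2).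
have mg : measurable_fun setT g.
  apply: (measurableT_comp mf); apply: measurable_fun_pair; first exact: measurableT_comp.
  apply: (@measurable_cons _ _ _ _ (fun z : T * measurableTypeR R * n.-tuple R => z.1.2 : R)) => //.
  exact: measurableT_comp.
apply: (measurable_fun_fubini_tonelli_F (m2 := leb)
  (fun z : T * measurableTypeR R => iint (fun s => g (z, s)))).
  by apply: IH => // z; exact: f0.
by move=> z; apply: iint_ge0 => s; exact: f0.
Qed.

Lemma measurable_iint_cons n (f : n.+1.-tuple R -> \bar R) :
  measurable_fun setT f -> (forall z, 0 <= f z)%E ->
  measurable_fun setT (fun y : measurableTypeR R => iint (fun s : n.-tuple R => f (@cons_tuple n R y s))).
Proof.
move=> mf f0.
apply: (@measurable_iint _ (measurableTypeR R) n (fun z => f (@cons_tuple n R z.1 z.2))) => //.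
apply: (measurableT_comp mf). exact: measurable_cons_tuple.
Qed.

Lemma measurable_cons1 n (y : R) : measurable_fun setT (fun s : n.-tuple R => @cons_tuple n R y s).
Proof. by apply: (@measurable_cons _ _ _ _ (fun=> y)). Qed.

Lemma iintD n (f g : n.-tuple R -> \bar R) :
  measurable_fun setT f -> (forall x, 0 <= f x)%E ->
  measurable_fun setT g -> (forall x, 0 <= g x)%E ->
  (iint (fun x => f x + g x) = iint f + iint g)%E.
Proof.
elim: n f g => [//|n IH] f g mf f0 mg g0; rewrite !iintS -ge0_integralD//.
- apply: eq_integral => y _; rewrite IH//.
  + exact: (measurableT_comp mf (measurable_cons1 y)).
  + exact: (measurableT_comp mg (measurable_cons1 y)).
- by move=> y _; exact: iint_ge0.
- exact: measurable_iint_cons.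
- by move=> y _; exact: iint_ge0.
- exact: measurable_iint_cons.
Qed.

Lemma iintZ n (c : R) (f : n.-tuple R -> \bar R) : 0 <= c ->
  measurable_fun setT f -> (forall x, 0 <= f x)%E ->
  (iint (fun x => c%:E * f x) = c%:E * iint f)%E.
Proof.
move=> c0; elim: n f => [//|n IH] f mf f0; rewrite !iintS -ge0_integralZl//.
- apply: eq_integral => y _; rewrite IH//.
  exact: (measurableT_comp mf (measurable_cons1 y)).
- exact: measurable_iint_cons.
- by move=> y _; exact: iint_ge0.
Qed.

Lemma iint_nneseries n (f : nat -> n.-tuple R -> \bar R) :
  (forall k, measurable_fun setT (f k)) -> (forall k x, 0 <= f k x)%E ->
  (iint (fun x => \sum_(k <oo) f k x) = \sum_(k <oo) iint (f k))%E.
Proof.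
elim: n f => [//|n IH] f mf f0; rewrite iintS -integral_nneseries//.
- apply: eq_integral => y _; rewrite IH// => k.
  exact: (measurableT_comp (mf k) (measurable_cons1 y)).
- by move=> k; exact: measurable_iint_cons.
- by move=> k y _; exact: iint_ge0.
Qed.

Lemma iint0 n : iint (fun _ : n.-tuple R => 0%E) = 0%E :> \bar R.
Proof.
elim: n => [//|n IH]; rewrite iintS; apply: integral0_eq => y _; exact: IH.
Qed.

(** Almost every section of a null set is null, so the claim descends to one dimension less. *)
Lemma iint_infty n (N : set (n.-tuple R)) : measurable N ->
  iint (fun x => (\1_N x)%:E) = 0%E ->
  iint (fun x => if x \in N then +oo%E else 0%E) = 0%E.
Proof.
elim: n N => [|n IH] N mN.
  by rewrite /= indicE; case: ifP => //= _ /eqP; rewrite eqe oner_eq0.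
pose Ny (y : R) := [set s : n.-tuple R | N (@cons_tuple n R y s)].
have mNy y : measurable (Ny y).
  by rewrite -[X in measurable X]setTI; exact: (measurable_cons1 y).
have inE' y s : (@cons_tuple n R y s \in N) = (s \in Ny y).
  by apply/idP/idP; rewrite !in_setE.
rewrite !iintS => i0.
have m1 : measurable_fun setT (fun y : measurableTypeR R =>
    iint (fun s : n.-tuple R => (\1_N (@cons_tuple n R y s))%:E)).
  apply: (@measurable_iint_cons n (fun x => (\1_N x)%:E)).
    by apply/measurable_EFinP; exact: measurable_indic.
  by move=> z; rewrite lee_fin.
have minf : measurable_fun setT (fun y : measurableTypeR R =>
    iint (fun s : n.-tuple R => if @cons_tuple n R y s \in N then +oo%E : \bar R else 0%E)).
  apply: (@measurable_iint_cons n (fun x => if x \in N then +oo%E else 0%E)).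
    apply: measurable_fun_ifT => //.
    by apply: (measurable_fun_bool true); rewrite setTI preimage_mem_true.
  by move=> z; case: ifP.
have : ae_eq leb setT (fun y => iint (fun s : n.-tuple R => (\1_N (@cons_tuple n R y s))%:E)) (cst 0%E).
  apply/ae_eq_integral_abs => //; rewrite -[RHS]i0; apply: eq_integral => y _.
  by rewrite gee0_abs//; apply: iint_ge0 => s; rewrite lee_fin.
move=> ae0; rewrite -[RHS](integral0 leb setT); apply: ge0_ae_eq_integral => //.
  by move=> y _; apply: iint_ge0 => s; case: ifP.
case: ae0 => M [mM M0 sM]; exists M; split=> // y /= yM; apply: sM => /= y0; apply: yM => _.
transitivity (iint (fun s : n.-tuple R => if s \in Ny y then +oo%E : \bar R else 0%E)).
  by congr iint; apply/funext => s; rewrite inE'.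
apply: IH => //; rewrite -[RHS](y0 I); congr iint; apply/funext => s.
Qed.

(** A set containing the unit ball whose volume factorises along the coordinates; it bounds the mass
    of [ball_measure]. *)
Definition unit_cube n (x : n.-tuple R) : bool := all (fun a => `|a| <= 1) x.

Lemma iint_unit_cube_lty n :
  (iint (fun x : n.-tuple R => if unit_cube x then 1 else 0) < +oo)%E.
Proof.
elim: n => [|n IH]; first by rewrite /= ltry.
rewrite iintS; set c := iint _ in IH.
have c0 : (0 <= c)%E by apply: iint_ge0 => s; case: ifP.
rewrite (eq_integral (fun y : measurableTypeR R => (fine c)%:E * (\1_(`[-1, 1]%classic : set R) (y : R))%:E)%E).
  rewrite ge0_integralZl//; first last.
  - by rewrite lee_fin fine_ge0.
  - by apply/measurable_EFinP; apply: measurable_indic; exact: measurable_itv.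
  rewrite integral_indic//.
  rewrite setIT [X in (_ * X)%E]lebesgue_measure_itv/=.
  by case: ifP => _; rewrite -?EFinB -?EFinM ?mule0 ltry.
move=> y _; rewrite indicE fineK ?ge0_fin_numE//.
have -> : (y \in (`[-1, 1]%classic : set R)) = (`|y| <= 1).
  by apply/idP/idP; rewrite in_setE/= in_itv/= -ler_norml.
rewrite /unit_cube/=; case: (`|y| <= 1); rewrite /= ?mule1 ?mule0//.
exact: iint0.
Qed.

End iint.

(** * Lebesgue measure restricted to the unit ball *)

Section ball_measure.
Context {R : realType} (n : nat).
Implicit Types A B : set (n.-tuple R).

Lemma measurable_dotp d (T : measurableType d) (f g : T -> n.-tuple R) :
  measurable_fun setT f -> measurable_fun setT g ->
  measurable_fun setT (fun t => dotp (f t) (g t)).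
Proof.
move=> /measurable_fun_tnthP mf /measurable_fun_tnthP mg.
by apply: measurable_sum => i; apply: measurable_funM; [exact: mf|exact: mg].
Qed.

Lemma measurable_tnorm : measurable_fun setT (@tnorm R n).
Proof.
apply: (@measurableT_comp _ _ _ _ _ _ (@Num.sqrt R)).
  by apply: continuous_measurable_fun; exact: sqrt_continuous.
by apply: measurable_dotp; exact: measurable_id.
Qed.

Definition unit_ball : set (n.-tuple R) := [set x | tnorm x <= 1].

Lemma measurable_unit_ball : measurable unit_ball.
Proof.
by apply: measurable_set_bool; apply: measurable_fun_ler => //; exact: measurable_tnorm.
Qed.

Lemma unit_ball_cube x : unit_ball x -> unit_cube x.
Proof.
rewrite /unit_ball/= /tnorm => x1; apply/allP => a /tnthP[i ->].
have dx0 : 0 <= dotp x x by apply: sumr_ge0 => j _; rewrite -expr2 sqr_ge0.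
have dx1 : dotp x x <= 1.
  by rewrite -(sqr_sqrtr dx0) expr_le1// sqrtr_ge0.
rewrite -(@expr_le1 _ 2)// real_normK ?num_real//; apply: le_trans dx1.
rewrite /dotp (bigD1 i)//= -expr2 lerDl.
by apply: sumr_ge0 => j _; rewrite -expr2 sqr_ge0.
Qed.

(* Lebesgue measure on the unit ball, where the integrand of [sphere_integral] lives. *)
Definition ball_measure A : \bar R := iint (fun x => (\1_(A `&` unit_ball) x)%:E).

Let mI A : measurable A -> measurable_fun setT (fun x => (\1_(A `&` unit_ball) x)%:E : \bar R).
Proof.
move=> mA; apply/measurable_EFinP; apply: measurable_indic; apply: measurableI => //.
exact: measurable_unit_ball.
Qed.

Let ball0 : ball_measure set0 = 0%E.
Proof.
rewrite -[RHS](@iint0 R n); congr iint; apply/funext => x.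
by rewrite set0I indicE in_set0.
Qed.

Let ball_ge0 A : (0 <= ball_measure A)%E.
Proof. by apply: iint_ge0 => x; rewrite lee_fin. Qed.

Let ball_sigma_additive : semi_sigma_additive ball_measure.
Proof.
move=> F mF tF mUF.
rewrite (_ : ball_measure _ = (\sum_(k <oo) ball_measure (F k))%E).
  by apply: is_cvg_nneseries => k _ _; exact: ball_ge0.
rewrite -iint_nneseries => [|k|k x]; last by rewrite lee_fin.
  congr iint; apply/funext => x; rewrite setI_bigcupl indic_bigcup//.
  exact: trivIset_setIr.
exact: mI.
Qed.

HB.instance Definition _ := isMeasure.Build _ _ _ ball_measure ball0 ball_ge0 ball_sigma_additive.

Let ball_finite : fin_num_fun ball_measure.
Proof.
move=> A mA; rewrite ge0_fin_numE//; apply: le_lt_trans (iint_unit_cube_lty n).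
apply: le_iint => x; first by rewrite lee_fin.
rewrite indicE; case: ifPn => xC; first by rewrite lee_fin lern1 leq_b1.
rewrite memNset// => -[_ /unit_ball_cube]; exact/negP.
Qed.

HB.instance Definition _ := Measure_isFinite.Build _ _ _ ball_measure ball_finite.

End ball_measure.

(** * Squeezing and integrating over the sphere *)

Section souslin_function.
Context d (T : measurableType d) (R : realType) (ell : {finite_measure set T -> \bar R}).

Let m_in (A : set T) : measurable A -> measurable_fun setT (fun t => t \in A).
Proof.
by move=> mA; apply: (measurable_fun_bool true); rewrite setTI preimage_mem_true.
Qed.

(** Each rational sublevel set is squeezed between measurable sets, and [N] collects the gaps. Off
    [N] the infimum of the rationals whose inner set contains [t] recovers [f t]; the value 0 on [N]
    keeps [g] below [f] everywhere. *)
Theorem souslin_fun_measurable (f : T -> \bar R) : (forall t, 0 <= f t)%E ->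
  (forall a : R, souslin [set t | (f t < a%:E)%E]) ->
  exists (g : T -> \bar R) (N : set T),
    [/\ measurable_fun setT g, measurable N, ell N = 0%E,
        forall t, (0 <= g t <= f t)%E & forall t, t \notin N -> f t = g t].
Proof.
move=> f0 sf.
have H n : exists AB : set T * set T, [/\ measurable AB.1, measurable AB.2,
    AB.1 `<=` [set t | (f t < (ratseq n : R)%:E)%E],
    [set t | (f t < (ratseq n : R)%:E)%E] `<=` AB.2 & ell (AB.2 `\` AB.1) = 0%E].
  by have [A [B ?]] := souslin_measurable ell (sf (ratseq n)); exists (A, B).
have [AB ABP] := choice H.
pose N := \bigcup_n ((AB n).2 `\` (AB n).1).
have mN : measurable N.
  by apply: bigcupT_measurable => n; have [? ? _ _ _] := ABP n; exact: measurableD.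
have N0 : ell N = 0%E.
  apply: measure_negligible => //; apply: negligible_bigcup => n.
  by have [? ? _ _ ?] := ABP n; exists ((AB n).2 `\` (AB n).1); split => //; exact: measurableD.
pose h n t : \bar R := if t \in (AB n).1 then (ratseq n)%:E else +oo%E.
have hE t : t \notin N -> f t = einfs (h ^~ t) 0%N.
  move=> tN.
  have AE n : (t \in (AB n).1) = (f t < (ratseq n : R)%:E)%E.
    have [_ _ Af fB _] := ABP n; apply/idP/idP; rewrite in_setE; first exact: Af.
    move=> ft; apply: contrapT => tA; move/negP: tN; apply; rewrite in_setE.
    by exists n => //; split=> //; exact: fB.
  apply/eqP; rewrite eq_le; apply/andP; split.
    apply/ereal_infP => _ [n _ <-]; rewrite /h AE; case: ifP => [/ltW//|_].
    by rewrite leey.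
  case ftE : (f t) => [r| |]; last by have := f0 t; rewrite ftE.
    apply/lee_addgt0Pr => e e0; have [|n /andP[rn ne]] := @ratseq_dense R r (r + e).
      by rewrite ltrDl.
    apply: ge_ereal_inf; exists (h n t); first by exists n.
    by rewrite /h AE ftE lte_fin rn -EFinD lee_fin ltW.
  by rewrite leey.
exists (fun t => if t \in N then 0%E else einfs (h ^~ t) 0%N), N; split => //.
- apply: measurable_fun_ifT => //; first exact: m_in.
  apply: measurable_fun_einfs => n; apply: measurable_fun_ifT => //; apply: m_in.
  by have [] := ABP n.
- move=> t; case: ifPn => [_|tN]; first by rewrite lexx f0.
  by rewrite -hE// lexx f0.
- by move=> t tN; rewrite (negbTE tN) hE.
Qed.

End souslin_function.

Section weighted_iint.
Context {R : realType} (n : nat).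
Variable w : n.-tuple R -> R.
Hypothesis mw : measurable_fun setT w.
Hypothesis w_ge0 : forall x, 0 <= w x.
Hypothesis w_ball : forall x, ~ unit_ball x -> w x = 0.

(* [iint] is a lower integral on non-measurable functions; for Souslin functions it
   is also an upper integral. *)
Lemma iint_upper (g : n.-tuple R -> \bar R) : (forall x, 0 <= g x)%E ->
  (forall a : R, souslin [set x | (g x < a%:E)%E]) ->
  exists G : n.-tuple R -> \bar R, [/\ measurable_fun setT G,
    forall x, ((w x)%:E * g x <= G x)%E &
    (iint G <= iint (fun x => (w x)%:E * g x))%E].
Proof.
move=> g0 /(souslin_fun_measurable (@ball_measure R n) g0)[h [N [mh mN N0 hg gh]]].
have h0 x : (0 <= h x)%E by have /andP[] := hg x.
have mNB : measurable (N `&` @unit_ball R n).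
  by apply: measurableI => //; exact: measurable_unit_ball.
pose o x : \bar R := if x \in N `&` @unit_ball R n then +oo%E else 0%E.
have mo : measurable_fun setT o.
  apply: measurable_fun_ifT => //.
  by apply: (measurable_fun_bool true); rewrite setTI preimage_mem_true.
have o0 x : (0 <= o x)%E by rewrite /o; case: ifP.
have mwh : measurable_fun setT (fun x => (w x)%:E * h x)%E.
  by apply: emeasurable_funM => //; exact/measurable_EFinP.
have wh0 x : (0 <= (w x)%:E * h x)%E by rewrite mule_ge0// lee_fin.
(* On the exceptional set inside the ball the term [o] is infinite but integrates to zero; outside
   the ball the weight vanishes. *)
exists (fun x => (w x)%:E * h x + o x)%E; split.
- exact: emeasurable_funD.
- move=> x; have [xN|xN] := boolP (x \in N); last by rewrite gh// leeDl.
  have [xB|xB] := pselect (unit_ball x); last by rewrite w_ball// !mul0e add0e.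
  rewrite /o ifT; last by rewrite in_setE; split=> //; rewrite -in_setE.
  by rewrite addey ?leey// gt_eqF// (lt_le_trans _ (wh0 x)).
- rewrite iintD// (_ : iint o = 0%E); last exact: iint_infty.
  rewrite adde0; apply: le_iint => // x.
  by rewrite lee_wpmul2l ?lee_fin//; have /andP[] := hg x.
Qed.

(** The measurable majorants from [iint_upper] can be added under the integral, and their integrals
    do not exceed those of the weighted [g] and [h]. *)
Lemma iint_triangle (K : R) (f g h : n.-tuple R -> \bar R) : 0 <= K ->
  (forall x, 0 <= f x)%E -> (forall x, 0 <= g x)%E -> (forall x, 0 <= h x)%E ->
  (forall a : R, souslin [set x | (g x < a%:E)%E]) ->
  (forall a : R, souslin [set x | (h x < a%:E)%E]) ->
  (forall x, f x <= K%:E * (g x + h x))%E ->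
  (iint (fun x => (w x)%:E * f x) <=
    K%:E * (iint (fun x => (w x)%:E * g x) + iint (fun x => (w x)%:E * h x)))%E.
Proof.
move=> K0 f0 g0 h0 sg sh fgh.
have [G [mG gG Gg]] := iint_upper g0 sg; have [H [mH hH Hh]] := iint_upper h0 sh.
have G0 x : (0 <= G x)%E by apply: le_trans (gG x); rewrite mule_ge0// lee_fin.
have H0 x : (0 <= H x)%E by apply: le_trans (hH x); rewrite mule_ge0// lee_fin.
have K0e : (0 <= K%:E)%E by rewrite lee_fin.
apply: (@le_trans _ _ (iint (fun x => K%:E * (G x + H x)))%E).
  apply: le_iint => x; first by rewrite mule_ge0// lee_fin.
  apply: (@le_trans _ _ ((w x)%:E * (K%:E * (g x + h x)))%E).
    by rewrite lee_wpmul2l// lee_fin.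
  by rewrite muleCA lee_wpmul2l// ge0_muleDr// leeD.
rewrite iintZ//; last 2 first.
- exact: emeasurable_funD.
- by move=> x; rewrite adde_ge0.
by rewrite lee_wpmul2l// iintD// leeD.
Qed.

End weighted_iint.

(** * Projections along directions and the power spherical weight *)

Section projections.
Context {R : realType} (d : nat).
Implicit Types (mu nu : probability (d.-tuple R) R) (x eps : d.-tuple R).

Definition normalize x : d.-tuple R := map_tuple (fun a => a / tnorm x) x.

Lemma measurable_normalize : measurable_fun setT normalize.
Proof.
apply/measurable_fun_tnthP => i.
(* Inversion is written as a power to obtain measurability; at the zero vector both forms give 0. *)
rewrite (_ : _ \o _ = (fun x => tnth x i * tnorm x `^ (-1))); last first.
  by apply/funext => x; rewrite /= tnth_map powR_inv1// sqrtr_ge0.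
apply: measurable_funM; first exact: measurable_tnth.
apply: (@measurableT_comp _ _ _ _ _ _ (@powR R ^~ (-1))); first exact: measurable_powR.
exact: measurable_tnorm.
Qed.

Lemma measurable_dotp1 x : measurable_fun setT (dotp x).
Proof. by apply: measurable_dotp. Qed.

Definition proj_law mu x : probability R R := law mu (measurable_dotp1 (normalize x)).

Lemma measurable_proj_law mu k : measurable_fun setT (fun x => proj_law mu x (ray k)).
Proof.
have mU : measurable [set z : d.-tuple R * d.-tuple R | dotp (normalize z.1) z.2 <= ratseq k].
  apply: measurable_set_bool; apply: measurable_fun_ler => //; apply: measurable_dotp => //.
  exact: (measurableT_comp measurable_normalize).
have := measurable_fun_xsection mu mU.
apply: eq_measurable_fun => x _ /=; congr (mu _).
by apply/seteqP; split=> u; rewrite /xsection/= in_setE.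
Qed.

Lemma PS_const_ge0 kappa : 0 <= PS_const kappa d :> R.
Proof.
have G0 s : 0 <= Gamma s :> R.
  apply: fine_ge0; apply: integral_ge0 => t _.
  by rewrite lee_fin mulr_ge0 ?powR_ge0 ?expR_ge0.
by rewrite invr_ge0 divr_ge0// !mulr_ge0 ?powR_ge0.
Qed.

(** The power spherical density without its normalising constant, extended radially to the punctured
    unit ball as the cone identity requires. *)
Definition PS_weight (kappa : R) eps x : R :=
  if (0 < tnorm x) && (tnorm x <= 1) then (1 + dotp eps (normalize x)) `^ kappa else 0.

Lemma measurable_PS_weight kappa eps : measurable_fun setT (PS_weight kappa eps).
Proof.
apply: measurable_fun_ifT => //.
- by apply: measurable_and; apply: measurable_fun_ltr || apply: measurable_fun_ler;
    rewrite //; exact: measurable_tnorm.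
- apply: (@measurableT_comp _ _ _ _ _ _ (@powR R ^~ kappa)).
    exact: measurable_powR.
  apply: measurable_funD => //; apply: measurable_dotp => //.
  exact: measurable_normalize.
Qed.

Lemma PS_weight_ge0 kappa eps x : 0 <= PS_weight kappa eps x.
Proof. by rewrite /PS_weight; case: ifP => // _; exact: powR_ge0. Qed.

Lemma PS_expectE eps kappa (f : d.-tuple R -> \bar R) :
  PS_expect eps kappa f = ((PS_const kappa d)%:E *
    (d%:R%:E * iint (fun x => (PS_weight kappa eps x)%:E * f (normalize x))))%E.
Proof.
rewrite /PS_expect /sphere_integral; congr (_ * (_ * iint _))%E.
by apply/funext => x; rewrite /PS_weight; case: ifP => //; rewrite mul0e.
Qed.

Lemma PS_expect_ge0 eps kappa (f : d.-tuple R -> \bar R) : (forall x, 0 <= f x)%E ->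
  (0 <= PS_expect eps kappa f)%E.
Proof.
move=> f0; rewrite PS_expectE mule_ge0 ?lee_fin ?PS_const_ge0// mule_ge0 ?lee_fin//.
by apply: iint_ge0 => x; rewrite mule_ge0// lee_fin PS_weight_ge0.
Qed.

Lemma sphere_nonempty : (0 < d)%N -> exists eps : d.-tuple R, sphere eps.
Proof.
move=> d0; pose i0 := Ordinal d0.
exists [tuple (i == i0)%:R | i < d]; rewrite /sphere/= /tnorm /dotp (bigD1 i0)//=.
rewrite !tnth_mktuple eqxx mulr1 big1 ?addr0 ?sqrtr1// => i /negbTE ii0.
by rewrite !tnth_mktuple ii0 mulr0.
Qed.

End projections.

(** * The pseudo-metric properties of [PSSFG] *)

Unset Implicit Arguments.

Theorem theorem7 (R : realType) (d : nat) (beta kappa : R) (d1 : R -> R -> R) :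
  (2 <= d)%N -> 0 <= beta <= 1 -> 0 < kappa ->
  pseudo_metric d1 ->
  measurable_fun setT (fun st : R * R => d1 st.1 st.2) ->
  [/\ (forall mu nu : probability (d.-tuple R) R,
         finite_moments mu -> finite_moments nu ->
         (0 <= PSSFG mu nu beta kappa d1)%E),
      (forall mu nu : probability (d.-tuple R) R,
         finite_moments mu -> finite_moments nu ->
         PSSFG mu nu beta kappa d1 = PSSFG nu mu beta kappa d1) &
      exists C' : R, 0 < C' /\
        forall mu nu xi : probability (d.-tuple R) R,
          finite_moments mu -> finite_moments nu -> finite_moments xi ->
          (PSSFG mu xi beta kappa d1
             <= C'%:E * (PSSFG mu nu beta kappa d1 + PSSFG nu xi beta kappa d1))%E].
Proof.
move=> d2 beta01 kappa0 [d1_ge0 d1C [C [C0 tri]]] md1.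
pose f (mu nu : probability (d.-tuple R) R) (th : d.-tuple R) :=
  D_fgw (pushforward mu (dotp th)) (pushforward nu (dotp th)) beta d1.
have f0 mu nu th : (0 <= f mu nu th)%E by exact: D_fgw_ge0.
have sf mu nu (a : R) : souslin [set x | (f mu nu (normalize x) < a%:E)%E].
  apply: (D_fgw_souslin beta md1 d1_ge0 (rho := proj_law mu) (eta := proj_law nu)) => n;
  exact: measurable_proj_law.
(* A point of the sphere is needed for non-negativity, since the supremum of the empty set is
   [-oo]. *)
have [eps0 seps0] := @sphere_nonempty R d (ltnW d2).
have PSSFG_ge0 (mu nu : probability (d.-tuple R) R) : (0 <= PSSFG mu nu beta kappa d1)%E.
  apply: le_ereal_sup_tmp; exists (PS_expect eps0 kappa (f mu nu)).
    by exists eps0.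
  exact: PS_expect_ge0.
split=> [mu nu _ _|mu nu _ _|]; first exact: PSSFG_ge0.
  rewrite /PSSFG; congr ereal_sup; congr image; apply/funext => eps.
  by congr PS_expect; apply/funext => th; rewrite D_fgwC.
have K0 : 0 < C + 2 by rewrite addr_gt0.
exists (C + 2); split=> // mu nu xi _ _ _.
apply: ub_ereal_sup => _ [eps seps <-].
(* It suffices to prove the inequality for a fixed [eps], because each expectation on the right is
   below its own supremum. The constant is the one of [D_fgw_triangle], independent of the
   direction. *)
apply: (@le_trans _ _ ((C + 2)%:E * (PS_expect eps kappa (f mu nu) +
    PS_expect eps kappa (f nu xi)))%E); last first.
  apply: lee_wpmul2l; first by rewrite lee_fin ltW.
  by apply: leeD; apply: ereal_sup_ubound; exists eps.
have c0 : (0 <= (PS_const kappa d)%:E)%E by rewrite lee_fin PS_const_ge0.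
have i0 mu' nu' :
    (0 <= iint (fun x => (PS_weight kappa eps x)%:E * f mu' nu' (normalize x)))%E.
  by apply: iint_ge0 => x; rewrite mule_ge0// lee_fin PS_weight_ge0.
rewrite !PS_expectE -ge0_muleDr ?mule_ge0 ?lee_fin// -ge0_muleDr//.
rewrite [leRHS]muleCA [X in (_ <= _ * X)%E]muleCA.
apply: lee_wpmul2l => //; apply: lee_wpmul2l; first by rewrite lee_fin.
apply: iint_triangle => //.
- exact: measurable_PS_weight.
- exact: PS_weight_ge0.
- by move=> x; rewrite /PS_weight/unit_ball/= => /negP/negbTE ->; rewrite andbF.
- exact: ltW.
- by move=> x; exact: f0.
- by move=> x; exact: D_fgw_triangle.
Qed.
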